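(* Let $G$ be a chain graph over a finite node set $V$, interpreted either as an LWF chain graph or as an AMP chain graph (the same interpretation being used for all chain graphs in the statement). Let $G_D$ be the DAG over $V$ containing exactly the directed edges of $G$, and let $G_S$ be the DAG over $V\cup S$ obtained from the undirected graph $G_U$ (over $V$, containing exactly the undirected edges of $G$) by replacing every undirected edge $X - Y$ with $X \rightarrow S_{XY} \leftarrow Y$, where the $S_{XY}$ are new nodes and $S$ is the set of all of them. Then $G$ is inclusion optimal with respect to $I(G_D) \cap [I(G_S)]_\emptyset^{S}$, i.e. $I(G)\subseteq I(G_D) \cap [I(G_S)]_\emptyset^{S}$ and there is no chain graph $H$ over $V$ (under the same interpretation) with $I(G) \subset I(H) \subseteq I(G_D) \cap [I(G_S)]_\emptyset^{S}$.
   Context: All graphs are simple (at most one edge between two nodes); edges are directed ($\rightarrow$) or undirected ($-$). A route between $V_1$ and $V_n$ is a sequence of not necessarily distinct nodes $V_1,\dots,V_n$ with $V_i$ and $V_{i+1}$ adjacent for all $i$; it is a path if its nodes are distinct. A route is a semidirected cycle if $V_n=V_1$, $V_1\rightarrow V_2$ is in the graph, and for all $1<i<n$ either $V_i\rightarrow V_{i+1}$ or $V_i - V_{i+1}$ is in the graph. A chain graph (CG) is a graph with directed and undirected edges and no semidirected cycle; a DAG is a CG with only directed edges, an undirected graph (UG) one with only undirected edges. LWF separation: a section of a route $\rho$ is a maximal undirected subroute of $\rho$; a section $V_2 - \dots - V_{n-1}$ is a collider section if $V_1\rightarrow V_2-\dots-V_{n-1}\leftarrow V_n$ is a subroute of $\rho$.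 For $Z\subseteq V$, $\rho$ is $Z$-open if every collider section of $\rho$ contains a node of $Z$ and no non-collider section contains a node of $Z$. AMP separation: a node $B$ in a route $\rho$ is a triplex node in $\rho$ if $A\rightarrow B\leftarrow C$, $A\rightarrow B - C$ or $A - B\leftarrow C$ is a subroute of $\rho$ (possibly $A=C$ in the first case); $\rho$ is $Z$-open if every triplex node in $\rho$ is in $Z$ and every non-triplex node in $\rho$ is outside $Z$ (a node occurrence may be both). For disjoint $X,Y,Z\subseteq V$, $X\perp_G Y\mid Z$ means there is no $Z$-open route in $G$ between a node of $X$ and a node of $Y$; $I(G)$ is the set of all such statements (the independence model of $G$); for DAGs and UGs the two interpretations coincide. For a CG $G$ over $V\cup L\cup S$ with $L,S$ disjoint, $[I(G)]_L^S$ is the set of statements $X\perp Y\mid Z$ with $X,Y,Z\subseteq V$ disjoint such that $X\perp_G Y\mid Z\cup S$ is in $I(G)$. An independence model is a set of statements $X\perp Y\mid Z$ over disjoint subsets. A CG $G$ is inclusion optimal with respect to an independence model $M$ if $I(G)\subseteq M$ and no CG $H$ satisfies $I(G)\subset I(H)\subseteq M$. *)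

(* Defs.v *)
From HB Require Import structures.
From mathcomp Require Import all_boot.
Set Implicit Arguments. Unset Strict Implicit. Unset Printing Implicit Defensive.

(* A graph over a finite node type T: [dir x y] means x -> y is in the graph,
   [und x y] means x - y is in the graph. *)
Record graph (T : finType) := Graph { dir : rel T; und : rel T }.

Definition adj (T : finType) (G : graph T) : rel T :=
  fun x y => [|| dir G x y, dir G y x | und G x y].

Definition simple_graph (T : finType) (G : graph T) : Prop :=
  [/\ forall x, ~~ dir G x x,
      forall x, ~~ und G x x,
      forall x y, und G x y = und G y x,
      forall x y, ~~ (dir G x y && dir G y x)
    & forall x y, ~~ (dir G x y && und G x y)].

Definition semidirected_cycle (T : finType) (G : graph T) (x y : T) (q : seq T) :=
  [/\ dir G x y, path (fun a b => dir G a b || und G a b) y q & last y q = x].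

Definition is_CG (T : finType) (G : graph T) : Prop :=
  simple_graph G /\ ~ exists x y q, semidirected_cycle G x y q.

Definition is_DAG (T : finType) (G : graph T) : Prop :=
  is_CG G /\ forall x y, ~~ und G x y.

(* A route V1,...,Vn is represented as x :: q (V1 = x, Vn = last x q). *)
Definition route (T : finType) (G : graph T) (x : T) (q : seq T) : Prop :=
  path (adj G) x q.

Section Separation.
Variables (T : finType) (G : graph T) (Z : {set T}) (x : T) (q : seq T).
Let s := x :: q.
Let n := size s.
Let v k := nth x s k.

(* [i, j] (positions, 0-based) is a section: a maximal undirected subroute *)
Definition is_section (i j : nat) : Prop :=
  [/\ i <= j < n,
      forall k, i <= k < j -> und G (v k) (v k.+1),
      i = 0 \/ ~~ und G (v i.-1) (v i)
    & j.+1 = n \/ ~~ und G (v j) (v j.+1)].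

Definition collider_section (i j : nat) : Prop :=
  [/\ 0 < i, j.+1 < n, dir G (v i.-1) (v i) & dir G (v j.+1) (v j)].

Definition lwf_open : Prop :=
  forall i j, is_section i j ->
    (collider_section i j -> exists2 k, i <= k <= j & v k \in Z) /\
    (~ collider_section i j -> forall k, i <= k <= j -> v k \notin Z).

Definition triplex (k : nat) : bool :=
  [&& 0 < k, k.+1 < n &
    let a := v k.-1 in let b := v k in let c := v k.+1 in
    [|| dir G a b && dir G c b, dir G a b && und G b c | und G a b && dir G c b]].

Definition amp_open : Prop :=
  forall k, k < n -> (triplex k -> v k \in Z) /\ (~~ triplex k -> v k \notin Z).
End Separation.

Inductive interp := LWF | AMP.

Definition Z_open (i : interp) (T : finType) (G : graph T) (Z : {set T})
  (x : T) (q : seq T) : Prop :=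
  match i with LWF => lwf_open G Z x q | AMP => amp_open G Z x q end.

(* independence models: sets of statements X _||_ Y | Z *)
Definition model (T : finType) := {set T} -> {set T} -> {set T} -> Prop.

Definition disjoint3 (T : finType) (X Y Z : {set T}) : bool :=
  [&& [disjoint X & Y], [disjoint X & Z] & [disjoint Y & Z]].

Definition indep_model (i : interp) (T : finType) (G : graph T) : model T :=
  fun X Y Z => disjoint3 X Y Z /\
    ~ exists x q, [/\ route G x q, x \in X, last x q \in Y & Z_open i G Z x q].

Definition model_incl (T : finType) (M N : model T) : Prop :=
  forall X Y Z, M X Y Z -> N X Y Z.

Definition model_cap (T : finType) (M N : model T) : model T :=
  fun X Y Z => M X Y Z /\ N X Y Z.

(* [M]_L^S for M a model over V + W, S : {set W}, L = W \ S *)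
Definition marg_cond (V W : finType) (M : model (V + W)%type) (S : {set W}) : model V :=
  fun X Y Z => disjoint3 X Y Z /\
    M (inl @: X) (inl @: Y) ((inl @: Z) :|: (inr @: S)).

Definition inclusion_optimal (i : interp) (V : finType) (G : graph V) (M : model V) : Prop :=
  model_incl (indep_model i G) M /\
  ~ exists H : graph V, [/\ is_CG H,
       model_incl (indep_model i G) (indep_model i H),
       ~ model_incl (indep_model i H) (indep_model i G)
     & model_incl (indep_model i H) M].

Definition G_D (V : finType) (G : graph V) : graph V :=
  Graph (dir G) (fun _ _ => false).

(* new nodes S_XY: one per undirected edge {X, Y} of G *)
Definition uedge (V : finType) (u : rel V) : pred {set V} :=
  fun A => [exists x, exists y, u x y && (A == [set x; y])].

Definition Snode (V : finType) (G : graph V) := {A : {set V} | uedge (und G) A}.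

Definition G_S (V : finType) (G : graph V) : graph (V + Snode G)%type :=
  Graph (fun a b : (V + Snode G)%type => match a, b with
                    | inl x, inr A => x \in val A
                    | _, _ => false end)
        (fun _ _ => false).

(* Main.v *)
(** An inclusion [I(H) <= I(G_D) /\ I(G_S)] forces every edge of [G] into [H], and
   [I(G) <= I(H)] forces every edge of [H] into [G], because nonadjacent nodes of
   a chain graph are separated by some set; so [G] and [H] have the same
   adjacencies. Evaluating [I(G) <= I(H)] at such separating sets then shows that
   they have the same complexes (LWF) or the same triplexes (AMP), and it remains
   to see that this makes every [G]-connection an [H]-connection.

   LWF: on a set of nodes all anterior to [{x, y} + Z], connection is reachability
   in the moral graph, which depends on adjacencies and complexes only. Start from
   the anterior set in [G] and peel off terminal blocks of [H] disjoint from
   [{x, y} + Z]: since a block can be left in [G] by a semidirected path, the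
   marriages it causes are also caused outside of it.

   AMP: induct by removing a terminal block [K] of [H]. As no arrow of [H] leaves
   [K], equality of triplexes allows shortening any open route of [G] that makes a
   detour through [K]. This gives in [G] the independences of [K] given its
   [H]-parents, and contraction and weak union rebuild from them, and from the
   induction hypothesis, every independence of [H]. *)

Require Import Defs.
From HB Require Import structures.
From mathcomp Require Import all_boot.
From Stdlib Require Import Classical.
From mathcomp Require Import zify.
Set Implicit Arguments. Unset Strict Implicit. Unset Printing Implicit Defensive.


(** The hypothesis is a one-sided inclusion of models, yet equality of local structures is needed.
    It is evaluated only at separators of nonadjacent pairs: such a set separates in [G] by
    construction and in [H] by inclusion, so both graphs are blocked by the same set and must agree
    on what lies between the pair. Openness of a route is a condition on neighbouring positions with
    bounded memory. Encoding it as reachability in a finite state graph turns the splicing of routes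
    into composition of [connect], or of counted runs when length must decrease. The obstacle common
    to both interpretations is that a block which is terminal in [H] need not be terminal in [G],
    where arrows may leave it. What [G] retains is that certain configurations around the block are
    shielded, because an unshielded one would have to occur in [H] too. The missing edges so
    obtained are oriented by the absence of semidirected cycles in [G]. *)

Definition semi (T : finType) (G : graph T) : rel T :=
  fun a b => dir G a b || und G a b.

Lemma adj_sym (T : finType) (G : graph T) : simple_graph G -> symmetric (adj G).
Proof. by case=> _ _ us _ _ a b; rewrite /adj (us b a) orbCA. Qed.

(** * Semidirected reachability and the orientation of chords *)

Section ChainGraph.
Variables (T : finType) (G : graph T).
Hypothesis cgG : is_CG G.
Implicit Types a b c : T.

Lemma cg_simple : simple_graph G. Proof. by case: cgG. Qed.

Lemma cg_und_sym : symmetric (und G). Proof. by case: cg_simple. Qed.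

Lemma cg_adj_sym : symmetric (adj G). Proof. exact: adj_sym cg_simple. Qed.

Lemma semi_adj a b : semi G a b -> adj G a b.
Proof. by rewrite /adj; case/orP=> ->; rewrite ?orbT. Qed.

Lemma cg_adj_irr a : adj G a a = false.
Proof.
by case: cg_simple => di ui _ _ _; rewrite /adj (negbTE (di a)) (negbTE (ui a)).
Qed.

Lemma cg_no_cycle a b : dir G a b -> connect (semi G) b a -> False.
Proof.
move=> ab /connectP[q pq e].
by case: cgG => _; apply; exists a, b, q; split.
Qed.

Lemma dir_asym a b : dir G a b -> dir G b a = false.
Proof. by case: cg_simple => _ _ _ /(_ a b) + _ => /[swap] ->; case: (dir G b a). Qed.

Lemma dir_und a b : dir G a b -> und G a b = false.
Proof. by case: cg_simple => _ _ _ _ /(_ a b) /[swap] ->; case: (und G a b). Qed.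

Lemma dir_und' a b : dir G a b -> und G b a = false.
Proof. by rewrite cg_und_sym; apply: dir_und. Qed.

Lemma dir_connect a b : dir G a b -> connect (semi G) a b.
Proof. by move=> ab; apply: connect1; rewrite /semi ab. Qed.

Lemma und_connect a b : und G a b -> connect (semi G) a b.
Proof. by move=> ab; apply: connect1; rewrite /semi ab orbT. Qed.

(** This lemma and the next three orient a chord of a semidirected path: any other orientation would
    close a semidirected cycle. *)
Lemma semi_closes a c : connect (semi G) a c -> adj G a c -> semi G a c.
Proof.
rewrite /semi => ac /or3P[-> | ca | ->] //; rewrite ?orbT //.
by case: (cg_no_cycle ca ac).
Qed.

Lemma dir_closes a b c :
  dir G a b -> connect (semi G) b c -> adj G a c -> dir G a c.
Proof.
move=> ab bc /or3P[// | ca | ac].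
  by case: (cg_no_cycle ca (connect_trans (dir_connect ab) bc)).
case: (cg_no_cycle ab (connect_trans bc _)).
by apply: und_connect; rewrite cg_und_sym.
Qed.

Lemma closes_dir a b c :
  connect (semi G) a b -> dir G b c -> adj G a c -> dir G a c.
Proof.
move=> ab bc /or3P[// | ca | ac].
  by case: (cg_no_cycle ca (connect_trans ab (dir_connect bc))).
case: (cg_no_cycle bc (connect_trans _ ab)).
by apply: und_connect; rewrite cg_und_sym.
Qed.

Lemma und_closes a b c :
  connect (und G) a b -> connect (und G) b c -> adj G a c -> und G a c.
Proof.
move=> ab bc.
have sub u v : connect (und G) u v -> connect (semi G) u v.
  by apply: connect_sub => ? ?; apply: und_connect.
have sym : connect_sym (und G) by apply: sym_connect_sym; apply: cg_und_sym.
have ac := connect_trans ab bc.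
case/or3P=> [d | d | //].
  by case: (cg_no_cycle d); apply: sub; rewrite sym.
by case: (cg_no_cycle d); apply: sub.
Qed.

End ChainGraph.

(** * LWF routes as runs of a state machine *)

Section LWFMachine.
Variables (T : finType) (G : graph T) (Z : {set T}).

(* A state is the current node of a route together with [None] if its section
   was not entered through an arrowhead, and otherwise [Some b] where [b] tells
   whether the section has already met [Z]. *)
Definition lstep : rel (T * option bool) := fun u w =>
  let: (v, s) := u in let: (v', s') := w in
  [|| [&& und G v v', (s == None) ==> (v' \notin Z)
        & s' == (if s is Some b then Some (b || (v' \in Z)) else None)],
      [&& dir G v' v, s != Some false, s' == None & v' \notin Z]
    | [&& dir G v v', s != Some true & s' == Some (v' \in Z)]].

(** The last section is never a collider section, which excludes ending in [Some true]; in state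
    [None] the avoidance of [Z] has been checked at every step. *)
Definition lopen (x y : T) :=
  x \notin Z /\ exists2 s, s != Some true & connect lstep (x, None) (y, s).

End LWFMachine.

Section LWFMachineRoutes.
Variables (T : finType) (G : graph T) (Z : {set T}).
Hypothesis simG : simple_graph G.

Lemma dir_xor a b : dir G a b -> (dir G b a = false) * (und G a b = false) * (und G b a = false).
Proof.
case: simG => _ _ us ds du d; have := ds a b; have := du a b; rewrite d (us b a).
by case: (dir G b a); case: (und G a b).
Qed.

Section Positions.
Variables (x : T) (q : seq T).
Let v k := nth x (x :: q) k.
Let n := size (x :: q).

Lemma section_extends i k : i <= k < n ->
  (forall l, i <= l < k -> und G (v l) (v l.+1)) ->
  exists2 j, k <= j < n & (forall l, i <= l < j -> und G (v l) (v l.+1)) /\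
    (j.+1 = n \/ ~~ und G (v j) (v j.+1)).
Proof.
move: {2}(n - k) (leqnn (n - k)) => m.
elim: m k => [|m IH] k lem ikn H; first by lia.
have [e|ne] := eqVneq k.+1 n.
  by exists k; [lia|split; [|left]].
have [u|nu] := boolP (und G (v k) (v k.+1)); last first.
  by exists k; [lia|split; [|right]].
case: (IH k.+1); [lia|lia| |].
  move=> l il; have [->//|nlk] := eqVneq l k; apply: H; lia.
by move=> j kj Hj; exists j; [lia|].
Qed.

Lemma lwf_open_states : route G x q -> lwf_open G Z x q -> lopen G Z x (last x q).
Proof.
move=> rt op.
have edge k : k.+1 < n -> adj G (v k) (v k.+1).
  by move=> kn; apply: (pathP x rt).
(* The section may continue beyond [k]; extending it to a maximal one shows that it is not a
   collider section, so it avoids [Z]. *)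
have clear i k : i <= k < n -> (forall l, i <= l < k -> und G (v l) (v l.+1)) ->
    (i = 0 \/ ~~ und G (v i.-1) (v i)) -> (i = 0 \/ ~~ dir G (v i.-1) (v i)) ->
    v k \notin Z.
  move=> ik H st nd; case: (section_extends ik H) => j jn [Hj ej].
  have sec : is_section G x q i j by split=> //; lia.
  have [_ ncol] := op _ _ sec; apply: ncol; last lia.
  by case=> i0 _ d _; case: nd => [|/negP//]; lia.
have inv k : k < n -> exists2 s, connect (lstep G Z) (x, None) (v k, s) &
    exists2 i, i <= k & [/\ forall l, i <= l < k -> und G (v l) (v l.+1),
      i = 0 \/ ~~ und G (v i.-1) (v i) &
      match s with
      | None => i = 0 \/ ~~ dir G (v i.-1) (v i)
      | Some b => [/\ 0 < i, dir G (v i.-1) (v i) &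
                   b <-> exists2 l, i <= l <= k & v l \in Z]
      end].
  elim: k => [|k IH] kn.
    exists None; first exact: connect0.
    by exists 0 => //; split; [lia|left|left].
  have [s cs [i ik [Hu st ds]]] := IH (ltnW kn).
  have [u|nu] := boolP (und G (v k) (v k.+1)).
    have Hu' l : i <= l < k.+1 -> und G (v l) (v l.+1).
      by move=> il; have [->//|nlk] := eqVneq l k; apply: Hu; lia.
    exists (if s is Some b then Some (b || (v k.+1 \in Z)) else None).
      apply: connect_trans cs (connect1 _); rewrite /= u eqxx andbT.
      case: s ds => //= nd; rewrite (clear i k.+1) //=; lia.
    exists i; first lia; split=> //; case: s ds {cs} => // b [i0 d bP]; split=> //.
    split=> [/orP[/bP[l il lZ]|kZ]|[l il lZ]].
    - by exists l => //; lia.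
    - by exists k.+1 => //; lia.
    - have [lk|nlk] := eqVneq l k.+1; first by rewrite -lk lZ orbT.
      by apply/orP; left; apply/bP; exists l => //; lia.
  have sec : is_section G x q i k by split=> //; [lia|right].
  have [col ncol] := op _ _ sec.
  have /or3P[d|d|] := edge _ kn; last by rewrite (negbTE nu).
    exists (Some (v k.+1 \in Z)).
      apply: connect_trans cs (connect1 _); rewrite /= d !eqxx.
      suff -> : s != Some true by rewrite !orbT.
      case: s ds => [[]|] // [_ _ [/(_ isT)[l il lZ] _]].
      have nc : ~ collider_section G x q i k.
        by case=> _ _ _; rewrite -/(v k) -/(v k.+1) (dir_xor d).
      by case/negP: (ncol nc l il).
    exists k.+1 => //; split; [lia|by right|split=> //].
    split=> [h|[l il lZ]]; first by exists k.+1 => //; lia.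
    by have -> : k.+1 = l by lia.
  have nd : ~~ dir G (v k) (v k.+1) by rewrite (dir_xor d).
  exists None.
    apply: connect_trans cs (connect1 _); rewrite /= d (clear k.+1 k.+1) ?leqnn //=.
    - suff -> : s != Some false by rewrite orbT.
      case: s ds => [[]|] // [i0 di [_ h]].
      have [l il lZ] : exists2 l, i <= l <= k & v l \in Z by apply: col.
      by have : false by apply: h; exists l.
    - by move=> l; lia.
    - by right.
    - by right.
  by exists k.+1 => //; split; [lia|right|right].
have n0 : n.-1 < n by [].
have [s cs [i ik [Hu st ds]]] := inv _ n0.
split; first by apply: (clear 0 0); [|lia|left|left].
exists s; last by move: cs; rewrite /v /n /= -last_nth.
have sec : is_section G x q i n.-1 by split=> //; [lia|left].
have [_ ncol] := op _ _ sec.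
case: s ds {cs} => [[]|] // [_ _ [/(_ isT)[l il lZ] _]].
have nc : ~ collider_section G x q i n.-1 by case=> _; rewrite ltnn.
by case/negP: (ncol nc l il).
Qed.

End Positions.

Lemma lwf_states_open x p : path (lstep G Z) (x, None) p -> x \notin Z ->
  (last (x, None) p).2 != Some true ->
  route G x (map fst p) /\ lwf_open G Z x (map fst p).
Proof.
move=> pp xZ lst; split.
  rewrite /route; elim: p x {lst xZ} (None : option bool) pp => //= -[w s'] p IH x s.
  case/andP=> st pp; rewrite (IH _ _ pp) andbT /adj.
  by case/or3P: st => /and3P[->]; rewrite ?orbT.
set q := map fst p; pose st k := nth (x, None) ((x, None) :: p) k.
have vE k : k < size (x :: q) -> nth x (x :: q) k = (st k).1.
  by move=> kn; rewrite /st -(nth_map _ x fst) //; move: kn; rewrite /= size_map.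
move=> i j [ij Hu sti enj].
set n := size (x :: q) in ij enj.
have nE : n = (size p).+1 by rewrite /n /= size_map.
have step k : k.+1 < n -> lstep G Z (st k) (st k.+1).
  by move=> kn; apply: (pathP (x, None) pp); lia.
(* Inside a section the machine never forgets how the section was entered; it only accumulates hits
   of [Z], recorded by [c]. *)
have inv k : i <= k <= j ->
    match (st i).2 with
    | None => (st k).2 = None /\ forall l, i <= l <= k -> (l = i) \/ (st l).1 \notin Z
    | Some b => exists2 c : bool, (st k).2 = Some (b || c) &
                  (c <-> exists2 l, i < l <= k & (st l).1 \in Z)
    end.
  elim: k => [|k IH] ik.
    have -> : i = 0 by lia.
    by case: (st 0).2 => [b|]; [exists false; rewrite ?orbF //; split=> // -[l il _]; exfalso; lia
      |split=> // l il; left; lia].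
  have [ik1|nik] := eqVneq i k.+1.
    rewrite -ik1; case: (st i).2 => [b|]; [exists false; rewrite ?orbF //; split=> // -[l il _]; exfalso; lia
      |split=> // l il; left; lia].
  have := Hu k; rewrite !vE; [|lia..] => /(_ ltac:(lia)) u.
  have := step k ltac:(lia); have := IH ltac:(lia).
  move: u; case: (st k) => [vk sk]; case ek': (st k.+1) => [vk' sk'] /= u.
  have nd1 : dir G vk vk' = false by apply/negP=> d; rewrite (dir_xor d) in u.
  have nd2 : dir G vk' vk = false by apply/negP=> d; rewrite (dir_xor d) in u.
  rewrite u nd1 nd2 /= !orbF.
  case: (st i).2 => [b [c -> cP] /= /eqP -> | [-> cl] /= /andP[vZ /eqP ->]].
    exists (c || (vk' \in Z)); first by rewrite orbA.
    split=> [/orP[/cP[l il lZ]|kZ]|[l il lZ]].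
    - by exists l => //; lia.
    - by exists k.+1; rewrite ?ek' //; lia.
    - have [lk|nlk] := eqVneq l k.+1; first by move: lZ; rewrite lk ek' => ->; rewrite orbT.
      by apply/orP; left; apply/cP; exists l => //; lia.
  split=> // l il; have [->|nlk] := eqVneq l k.+1; first by rewrite ek'; right.
  by apply: cl; lia.
have start : (match (st i).2 with
    | None => (st i).1 \notin Z /\ ~ (0 < i /\ dir G (st i.-1).1 (st i).1)
    | Some b => [/\ 0 < i, dir G (st i.-1).1 (st i).1 & b = ((st i).1 \in Z)]
    end : Prop).
  have [i0|i0] := posnP i; first by rewrite i0 /=; split=> // -[].
  have := step i.-1; rewrite prednK // => /(_ ltac:(lia)).
  case: sti => [|]; first lia; rewrite !vE; [|lia..].
  case: (st i.-1) (st i) => [a s] [b s'] /= nu.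
  rewrite (negbTE nu) /= => /orP[/and4P[d _ /eqP-> bZ]|/and3P[d _ /eqP->]] //.
  by split=> // -[_]; rewrite (dir_xor d).
(* The condition on the state at the right end comes from the step that leaves the section, or from
   acceptance at the end of the route. *)
have stop : [/\ collider_section G x q i j -> (st j).2 != Some false &
     ~ (j.+1 < n /\ dir G (st j.+1).1 (st j).1) -> (st j).2 != Some true].
  case: enj => [jn|nu].
    split=> [[_ jn' _ _]|_].
      by have := jn' : j.+1 < n; rewrite ltnNge ?jn // -jn leqnn.
    have -> : st j = last (x, None) p by rewrite (last_nth (x, None)) /st; congr nth; lia.
    by [].
  have [jn|jn] := leqP n j.+1.
    have jE : j = size p by lia.
    split=> [[_ jn' _ _]|_].
      by have := jn' : j.+1 < n; rewrite ltnNge jn.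
    have -> : st j = last (x, None) p by rewrite (last_nth (x, None)) /st jE.
    by [].
  have := step j jn; move: nu; rewrite /collider_section !vE; [|lia..].
  case: (st j) (st j.+1) => [a s] [b s'] /= nu; rewrite (negbTE nu) /=.
  case/orP=> [/and4P[d sf _ _]|/and3P[d sf _]]; split=> //.
  - by move=> h; case: h.
  - by case=> _ _ _; rewrite (dir_xor d).
have vE' k : i <= k <= j -> nth x (x :: q) k = (st k).1.
  by case/andP: ij => _ jn /andP[_ kj]; rewrite vE //; apply: leq_ltn_trans jn.
have iij : i <= i <= j by rewrite leqnn; case/andP: ij.
have jij : i <= j <= j by rewrite leqnn andbT; case/andP: ij.
have iN : i.-1 < size (x :: q).
  by case/andP: ij => le_ij jn; apply: leq_ltn_trans (leq_pred _) (leq_ltn_trans le_ij jn).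
have := inv j ltac:(lia); case: stop => stop1 stop2.
have clearN : (st i).2 = None -> forall k, i <= k <= j -> nth x (x :: q) k \notin Z.
  move=> si k ik; rewrite vE' //.
  have := inv k ik; move: start; rewrite si => -[iZ _] [_ /(_ k)] [|->//|//]; lia.
move: start; case si: (st i).2 => [b|].
  move=> [i0 di bE] [c cj cP]; split=> [col|ncol k ik].
    have := stop1 col; rewrite cj => bc.
    have {}bc : b || c by move: bc; case: (b || c).
    case/orP: bc => [bt|/cP[l il lZ]].
      by exists i; rewrite // vE' // -bE.
    have il' : i <= l <= j by case/andP: il => /ltnW-> ->.
    by exists l; rewrite // vE'.
  have : (st j).2 != Some true.
    apply: stop2 => -[jn dj]; apply: ncol; split=> //; first by rewrite vE // vE'.
    by rewrite vE // vE'.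
  rewrite cj vE' //.
  have [->|nki] := eqVneq k i; first by rewrite -bE; case: b {si bE cj}.
  apply: contra => kZ; suff -> : c by rewrite orbT.
  apply/cP; exists k => //.
  by case/andP: ik => ik kj; rewrite kj andbT ltn_neqAle ik andbT eq_sym.
move=> [iZ nd] _; split=> [col|_]; last exact: clearN.
by case: nd; case: col => i0 _ d _; split=> //; move: d; rewrite (vE' i iij) (vE _ iN).
Qed.

Lemma lopenP x y :
  (exists q, [/\ route G x q, last x q = y & lwf_open G Z x q]) <-> lopen G Z x y.
Proof.
split=> [[q [rt <- op]]|[xZ [s st /connectP[p pp e]]]]; first exact: lwf_open_states.
have [|rt op] := lwf_states_open pp xZ; first by rewrite -e.
exists (map fst p); split=> //.
by rewrite -[x]/((x, None : option bool).1) last_map -e.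
Qed.

End LWFMachineRoutes.

(** * AMP routes as runs of a state machine *)

(* The end mark at [b] of the edge between [a] and [b]: [Some true] for an
   arrowhead, [Some false] for a tail, [None] for an undirected edge. *)
Definition mk (T : finType) (G : graph T) (a b : T) : option bool :=
  if dir G a b then Some true else if und G a b then None else Some false.

Definition tri (m m' : option bool) : bool :=
  match m, m' with
  | Some true, Some true | Some true, None | None, Some true => true
  | _, _ => false
  end.

Lemma triC m m' : tri m m' = tri m' m.
Proof. by case: m m' => [[]|] [[]|]. Qed.

Lemma tri_tail m : tri m (Some false) = false.
Proof. by case: m => [[]|]. Qed.

Section AMPMachine.
Variables (T : finType) (G : graph T) (Z : {set T}).

(* A state is the current node of a route with the mark of the last edge at it;
   the start counts as a tail, since neither creates a triplex. *)
Definition astep : rel (T * option bool) := fun u w =>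
  [&& adj G u.1 w.1, w.2 == mk G u.1 w.1 & tri u.2 (mk G w.1 u.1) == (u.1 \in Z)].

Definition aopen (x y : T) : bool :=
  (y \notin Z) && [exists m, connect astep (x, Some false) (y, m)].

Hypothesis simG : simple_graph G.

Lemma mk_dir a b : dir G a b -> mk G a b = Some true.
Proof. by rewrite /mk => ->. Qed.

Lemma mk_rid a b : dir G a b -> mk G b a = Some false.
Proof. by rewrite /mk => d; rewrite !(dir_xor simG d). Qed.

Lemma mk_und a b : und G a b -> mk G a b = None.
Proof.
rewrite /mk => u; rewrite u; case d: (dir G a b) => //.
by rewrite (dir_xor simG d) in u.
Qed.

Lemma und_symm : symmetric (und G). Proof. by case: simG. Qed.

Lemma mk_dnu a b : und G a b -> mk G b a = None.
Proof. by rewrite und_symm; apply: mk_und. Qed.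

Lemma triplex3 a b c : adj G a b -> adj G b c ->
  [|| dir G a b && dir G c b, dir G a b && und G b c | und G a b && dir G c b]
  = tri (mk G a b) (mk G c b).
Proof.
move=> /or3P[] d1 /or3P[] d2.
- by rewrite (mk_dir d1) (mk_rid d2) !(dir_xor simG d2) !(dir_xor simG d1) !andbF.
- by rewrite (mk_dir d1) (mk_dir d2) d1 d2.
- by rewrite (mk_dir d1) (mk_dnu d2) d1 d2 orbT.
- by rewrite (mk_rid d1) !(dir_xor simG d1).
- by rewrite (mk_rid d1) !(dir_xor simG d1).
- by rewrite (mk_rid d1) !(dir_xor simG d1).
- by rewrite (mk_und d1) (mk_rid d2) !(dir_xor simG d2) !andbF.
- by rewrite (mk_und d1) (mk_dir d2) d1 d2 !orbT.
- rewrite (mk_und d1) (mk_dnu d2) d1 d2.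
  case e: (dir G a b); first by rewrite (dir_xor simG e) in d1.
  by case e': (dir G c b) => //; rewrite (dir_xor simG e') in d2.
Qed.

Section Positions.
Variables (x : T) (q : seq T).
Let v k := nth x (x :: q) k.
Let n := size (x :: q).

Definition mark_at k := if k is k'.+1 then mk G (v k') (v k) else Some false.

Lemma triplex_tri k : route G x q -> k < n ->
  triplex G x q k = (k.+1 < n) && tri (mark_at k) (mk G (v k.+1) (v k)).
Proof.
move=> rt; case: k => [|k] kn; first by rewrite /triplex /= andbF.
rewrite /triplex -/n /=; case: (ltnP k.+2 n) => //= kn'.
apply: triplex3; first exact: (pathP x rt).
exact: (pathP x rt k.+1).
Qed.

Lemma amp_open_states : route G x q -> amp_open G Z x q -> aopen x (last x q).
Proof.
move=> rt op.
have inv k : k < n -> connect astep (x, Some false) (v k, mark_at k).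
  elim: k => [|k IH] kn; first exact: connect0.
  apply: connect_trans (IH (ltnW kn)) (connect1 _).
  rewrite /astep [(_, _).1]/= [(_, _).2]/= eqxx.
  have -> /= : adj G (v k) (v k.+1) by apply: (pathP x rt).
  have := triplex_tri rt (ltnW kn); rewrite kn /= => <-.
  have := op k (ltnW kn); rewrite -/(v k).
  by case: (triplex _ _ _ _) => -[h1 h2]; [rewrite h1|rewrite (negbTE (h2 _))].
have n0 : n.-1 < n by [].
have lE : v n.-1 = last x q by rewrite (last_nth x).
rewrite /aopen -lE; apply/andP; split; last by apply/existsP; eexists; apply: inv.
have := op n.-1 n0; rewrite triplex_tri // ltnn => -[_]; exact.
Qed.

End Positions.

Lemma amp_states_open x p : path astep (x, Some false) p ->
  (last (x, Some false) p).1 \notin Z ->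
  route G x (map fst p) /\ amp_open G Z x (map fst p).
Proof.
move=> pp lst.
have rt : route G x (map fst p).
  rewrite /route; elim: p x {lst} (Some false : option bool) pp => //= u p IH x s.
  by case/andP=> /and3P[-> _ _]; case: u => ? ?; apply: IH.
split=> //; pose st k := nth (x, Some false) ((x, Some false) :: p) k.
have vE k : k < size (x :: map fst p) -> nth x (x :: map fst p) k = (st k).1.
  by move=> kn; rewrite /st -(nth_map _ x fst) //; move: kn; rewrite /= size_map.
have step k : k < size p -> astep (st k) (st k.+1) by move=> kn; apply: (pathP _ pp).
have mE k : k < size (x :: map fst p) -> mark_at x (map fst p) k = (st k).2.
  case: k => // k kn; rewrite /mark_at !vE //; last exact: ltnW.
  have kn' : k < size p by move: kn; rewrite /= size_map ltnS.
  by have /and3P[_ /eqP/esym e _] := step _ kn'; exact: e.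
move=> k kn; rewrite triplex_tri // mE // (vE k) //.
case: ltnP => kn'; rewrite ?andTb ?andFb; last first.
  split=> // _; suff -> : st k = last (x, Some false) p by [].
  rewrite (last_nth (x, Some false)) /st; congr nth.
  by move: kn kn'; rewrite /= size_map; lia.
rewrite vE //; have {}kn' : k < size p by move: kn'; rewrite /= size_map ltnS.
have /and3P[_ _ /eqP->] := step _ kn'.
by case: (_ \in Z).
Qed.

Lemma aopenP x y :
  (exists q, [/\ route G x q, last x q = y & amp_open G Z x q]) <-> aopen x y.
Proof.
split=> [[q [rt <- op]]|/andP[yZ /existsP[m /connectP[p pp e]]]]; first exact: amp_open_states.
have [|rt op] := amp_states_open pp; first by rewrite -e.
exists (map fst p); split=> //.
by rewrite -[x]/((x, Some false : option bool).1) last_map -e.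
Qed.

End AMPMachine.

(** * Shortening AMP-open routes *)

Section AMPReach.
Variables (T : finType) (G : graph T) (Z : {set T}).

(** Counting the steps makes route length an induction measure for the surgeries below. *)
Fixpoint rch (x : T) (n : nat) (s : T * option bool) : bool :=
  if n is n'.+1 then [exists u, rch x n' u && astep G Z u s]
  else s == (x, Some false).

Lemma rch0 x : rch x 0 (x, Some false). Proof. exact: eqxx. Qed.

Lemma rchS x n v m w : rch x n (v, m) -> adj G v w ->
  tri m (mk G w v) = (v \in Z) -> rch x n.+1 (w, mk G v w).
Proof.
move=> rv avw tv /=; apply/existsP; exists (v, m); rewrite rv /astep /=.
by rewrite avw eqxx tv eqxx.
Qed.

Lemma rch_inv x n w mw : rch x n.+1 (w, mw) -> exists v m,
  [/\ rch x n (v, m), adj G v w, mw = mk G v w & tri m (mk G w v) = (v \in Z)].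
Proof.
by case/existsP=> -[v m] /andP[rv /and3P[avw /eqP e /eqP t]]; exists v, m.
Qed.

Lemma rch_connect x s : connect (astep G Z) (x, Some false) s <-> exists n, rch x n s.
Proof.
split=> [/connectP[p pp ->]|[n]].
  exists (size p); elim/last_ind: p pp => [|p u IH]; first by rewrite rch0.
  rewrite rcons_path size_rcons last_rcons => /andP[/IH r st].
  by apply/existsP; exists (last (x, Some false) p); apply/andP.
elim: n s => [|n IH] s; first by move=> /eqP->; apply: connect0.
by case/existsP=> u /andP[/IH c st]; apply: connect_trans c (connect1 st).
Qed.

Lemma aopen_rch x y :
  aopen G Z x y <-> y \notin Z /\ exists n m, rch x n (y, m).
Proof.
rewrite /aopen; split=> [/andP[-> /existsP[m /rch_connect[n r]]]|[-> [n [m r]]]].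
  by split=> //; exists n, m.
by apply/existsP; exists m; apply/rch_connect; exists n.
Qed.

(** The start has a tail as its mark, hence is never a triplex node. *)
Lemma rch_start x n v m : rch x n (v, m) -> v \notin Z -> x \notin Z.
Proof.
case: n => [|n]; first by case/eqP=> ->.
move=> + _; elim: n v m => [|n IH] w mw /rch_inv[v [m [r _ _ t]]]; last exact: IH r.
by move: r t => /eqP[-> ->]; rewrite triC tri_tail => <-.
Qed.

End AMPReach.

(** Deleted nodes become isolated instead of leaving the node type, so no change of type is needed
    in the inductions. *)
Definition gdel (T : finType) (G : graph T) (K : {set T}) : graph T :=
  Graph (fun a b => [&& a \notin K, b \notin K & dir G a b])
        (fun a b => [&& a \notin K, b \notin K & und G a b]).

Section Deletion.
Variables (T : finType) (G : graph T) (K : {set T}).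

Lemma adj_gdel a b : adj (gdel G K) a b = [&& a \notin K, b \notin K & adj G a b].
Proof. by rewrite /adj /=; case: (a \in K); case: (b \in K). Qed.

Lemma mk_gdel a b : a \notin K -> b \notin K -> mk (gdel G K) a b = mk G a b.
Proof. by rewrite /mk /= => -> ->. Qed.

Lemma gdel_CG : is_CG G -> is_CG (gdel G K).
Proof.
move=> cg; have [di ui us ds du] := cg_simple cg; split.
  split=> [a|a|a b|a b|a b] /=.
  - by rewrite (negbTE (di a)) !andbF.
  - by rewrite (negbTE (ui a)) !andbF.
  - by rewrite us; do 2!case: (_ \notin K).
  - by apply: contra (ds a b) => /andP[/and3P[_ _ ->] /and3P[_ _ ->]].
  - by apply: contra (du a b) => /andP[/and3P[_ _ ->] /and3P[_ _ ->]].
case=> x [y [q [/and3P[_ _ d] pq e]]].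
apply: (cg_no_cycle cg d); apply/connectP; exists q => //.
by apply: sub_path pq => a b /orP[] /and3P[_ _]; rewrite /semi => ->; rewrite ?orbT.
Qed.

End Deletion.

Section AMPShortcuts.
Variables (T : finType) (G : graph T) (Z : {set T}).
Hypothesis cgG : is_CG G.
Let simG := cg_simple cgG.

(** The second route is traversed backwards: [tri] is symmetric, so its nodes keep their status. *)
Lemma rch_join x i y j v m m' : rch G Z x i (v, m) -> rch G Z y j (v, m') ->
  tri m m' = (v \in Z) -> exists m'', rch G Z x (i + j) (y, m'').
Proof.
elim: j i v m m' => [|j IH] i v m m' rx /=; first by case/eqP=> <- _; exists m; rewrite addn0.
move=> /rch_inv[l [ml [rl alv -> tl]]] tv; rewrite addnS -addSn.
apply: (IH i.+1 l (mk G v l) ml) => //; last by rewrite triC.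
by apply: (rchS rx) => //; rewrite cg_adj_sym.
Qed.

Lemma rch_bridge x i y j q mq a ma : rch G Z x i (q, mq) -> rch G Z y j (a, ma) ->
  adj G q a -> tri mq (mk G a q) = (q \in Z) -> tri ma (mk G q a) = (a \in Z) ->
  exists m, rch G Z x (i + j).+1 (y, m).
Proof.
move=> rx ry aqa tq ta; rewrite -addSn.
by apply: (rch_join (rchS rx aqa tq) ry); rewrite triC.
Qed.

Lemma rch_sym x n y m : rch G Z x n (y, m) -> y \notin Z -> exists m', rch G Z y n (x, m').
Proof.
move=> r yZ; have := rch_join (rch0 G Z y) r; rewrite add0n; apply.
by rewrite (negbTE yZ) triC tri_tail.
Qed.

Section Block.
Variable K : {set T}.
Hypothesis KZ : forall k, k \in K -> k \notin Z.
(* What [G] inherits when [K] is a terminal block of a graph with the same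
   triplexes: the edges from outside point into [K] there, so a triplex of [G]
   with its middle node before [K], or a nontriplex of [G] at the boundary of [K],
   is shielded. *)
Hypothesis HK1 : forall c u k, u \notin K -> k \in K -> adj G c u -> adj G u k ->
  tri (mk G c u) (mk G k u) -> c = k \/ adj G c k.
Hypothesis HK2 : forall a k q, a \notin K -> k \in K -> adj G a k -> adj G k q ->
  ~~ tri (mk G a k) (mk G q k) -> a = q \/ adj G a q.

(** The triplex node [u] is skipped, whether or not it lies in [Z]. By [HK1], [v] can turn to [k]
    directly, unless this changes whether [v] is a triplex node. In that case the mark at [v] is not
    a tail, so [v] has a predecessor [v'], and the claim is applied to a shorter route. *)
Lemma detour x n v mv u k : rch G Z x n (v, mv) -> adj G v u ->
  tri mv (mk G u v) = (v \in Z) -> u \notin K -> k \in K -> adj G u k ->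
  tri (mk G v u) (mk G k u) -> exists n' m', n' <= n.+1 /\ rch G Z x n' (k, m').
Proof.
elim/ltn_ind: n v mv u k => n IH v mv u k rv avu cv uK kK auk tvk.
have [vk|avk] := HK1 uK kK avu auk tvk.
  by exists n, mv; rewrite -vk.
have [ok|fail] := eqVneq (tri mv (mk G k v)) (v \in Z).
  by exists n.+1, (mk G v k); split=> //; apply: rchS rv _ _.
have {}fail : tri mv (mk G k v) != tri mv (mk G u v) by rewrite cv.
have mvt : mv <> Some false by move=> e; move: fail; rewrite e triC tri_tail triC tri_tail.
case: n IH rv => [|n] IH rv; first by case: mvt; case/eqP: rv.
have [v' [mv' [rv' av' emv cv']]] := rch_inv rv.
have ih w mw : rch G Z x n (w, mw) -> adj G w u -> tri mw (mk G u w) = (w \in Z) ->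
    tri (mk G w u) (mk G k u) -> exists n' m', n' <= n.+2 /\ rch G Z x n' (k, m').
  move=> rw awu cw tw; have [//|n' [m' [le r]]] := IH n _ w mw u k rw awu cw uK kK auk tw.
  by exists n', m'; split=> //; clear - le; lia.
(* Here [v] takes the role of the triplex node to be skipped, between [v'] and [k]. *)
have outside : v \notin K -> tri mv (mk G k v) ->
    exists n' m', n' <= n.+2 /\ rch G Z x n' (k, m').
  move=> vK tk; move: tk; rewrite emv => tk.
  have [//|n' [m' [le r]]] := IH n _ v' mv' v k rv' av' cv' vK kK avk tk.
  by exists n', m'; split=> //; clear - le; lia.
have vZ : v \in K -> ~~ tri mv (mk G u v) by move=> /KZ; rewrite cv.
have := avu; case/or3P=> dvu; last 2 first.
- by move: tvk; rewrite (mk_rid simG dvu) triC tri_tail.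
- have := auk; case/or3P=> duk; first by move: tvk; rewrite (mk_rid simG duk) tri_tail.
    have dkv : dir G k v.
      apply: (dir_closes cgG duk) => //; last by rewrite cg_adj_sym.
      by apply: und_connect; rewrite cg_und_sym.
    have mvN : mv = None.
      move: fail; rewrite (mk_dir dkv) (mk_dnu simG dvu).
      by case: (mv) mvt => [[]|].
    have tk : tri mv (mk G k v) by rewrite mvN (mk_dir dkv).
    have [vK|vK] := boolP (v \in K); last exact: outside.
    have uv' : und G v' v.
      move: emv; rewrite mvN /mk; case: (dir G v' v) => //; by case: (und G v' v).
    (* As a node of [K], [v] is outside [Z], hence not a triplex node, so [HK2] shields [u] and
       [v']. *)
    have [uv|auv'] : u = v' \/ adj G u v'.
    + apply: (HK2 uK vK); [by rewrite cg_adj_sym|by rewrite cg_adj_sym|].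
      by rewrite triC -emv; apply: vZ.
    + rewrite -uv in rv' av' emv cv' uv' *.
      have [mt|mnt] := eqVneq mv' (Some false).
        have uZ : u \notin Z by move: cv'; rewrite mt triC tri_tail => <-.
        exists n.+1, (mk G u k); split; first by clear; lia.
        by apply: (rchS rv') => //; rewrite mt triC tri_tail (negbTE uZ).
      case: n IH rv rv' {ih outside} => [|n] IH rv rv'; first by case/eqP: rv' mnt => _ ->.
      have [w [mw [rw aw ew cw]]] := rch_inv rv'.
      have [||n' [m' [le r]]] := IH n _ w mw u k rw aw cw uK kK auk; first by clear; lia.
        by rewrite -ew (mk_dir duk); case: (mv') mnt => [[]|].
      by exists n', m'; split=> //; clear - le; lia.
    + have dv'u : und G v' u.
        by apply: (und_closes cgG (connect1 uv') (connect1 dvu)); rewrite cg_adj_sym.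
      apply: (ih v' mv') => //; first by rewrite cg_adj_sym.
        by rewrite (mk_dnu simG dv'u) -cv' (mk_dnu simG uv').
      by rewrite (mk_und simG dv'u) (mk_dir duk).
  by move: tvk; rewrite (mk_und simG dvu) (mk_dnu simG duk).
have mkuv := mk_rid simG dvu.
have tk : tri mv (mk G k v).
  by move: fail; rewrite mkuv tri_tail; case: (tri _ _).
have [vK|vK] := boolP (v \in K); last exact: outside.
have := auk; case/or3P=> duk; first by move: tvk; rewrite (mk_rid simG duk) tri_tail.
  have nuv : u <> v'.
    move=> e; move: mvt; rewrite emv -e mkuv; exact.
  have [//|auv'] : u = v' \/ adj G u v'.
    apply: (HK2 uK vK); [by rewrite cg_adj_sym|by rewrite cg_adj_sym|].
    by rewrite triC -emv; apply: vZ.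
  have av'u : adj G v' u by rewrite cg_adj_sym.
  have := av'; case/or3P=> dv'.
  - have dv'u : dir G v' u by apply: (dir_closes cgG dv' (dir_connect dvu)).
    apply: (ih v' mv') => //; first by rewrite (mk_rid simG dv'u) -cv' (mk_rid simG dv').
    by rewrite (mk_dir dv'u) (mk_dir duk).
  - by case: mvt; rewrite emv (mk_rid simG dv').
  - have dv'u : dir G v' u by apply: (closes_dir cgG (und_connect dv') dvu).
    have tt : tri (mk G v' u) (mk G k u) by rewrite (mk_dir dv'u) (mk_dir duk).
    have [v'Z|v'Z] := boolP (v' \in Z); last first.
      by apply: (ih v' mv') => //; rewrite (mk_rid simG dv'u) tri_tail (negbTE v'Z).
    have v'K : v' \notin K by apply/negP=> /KZ; rewrite v'Z.
    move: cv'; rewrite (mk_dnu simG dv') v'Z => cv'.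
    case: n IH rv rv' {ih outside} => [|n] IH rv rv'; first by case/eqP: rv' cv' => _ ->.
    have [w [mw [rw aw ew cw]]] := rch_inv rv'.
    (* [v'] cannot step to [u], since it would no longer be a triplex node. It is skipped on the way
       to [v] instead; this reaches [v] sooner, and the claim applies once more from there. *)
    have [||n1 [m1 [le1 r1]]] := IH n _ w mw v' v rw aw cw v'K vK av'; first by clear; lia.
      by rewrite -ew (mk_dnu simG dv').
    have [||n' [m' [le r]]] := IH n1 _ v m1 u k r1 avu _ uK kK auk tvk; first by clear - le1; lia.
      by rewrite mkuv tri_tail (negbTE (KZ vK)).
    by exists n', m'; split=> //; clear - le le1; lia.
have dvk : dir G v k by apply: (dir_closes cgG dvu (und_connect duk)).
by move: tk; rewrite (mk_rid simG dvk) tri_tail.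
Qed.

(* Here [a] is a triplex node in [Z] that cannot be skipped directly: reach [k]
   without [a] instead, and leave [k] through its tail. *)
Lemma bypass x i q mq k a ma j y : rch G Z x i (q, mq) -> rch G Z y j (a, ma) ->
  adj G q k -> adj G k a -> k \in K -> a \notin K -> mk G q k = Some false ->
  tri ma (mk G k a) -> tri ma (mk G k a) = (a \in Z) ->
  tri mq (mk G k q) = (q \in Z) ->
  exists n m, n <= (i + j).+1 /\ rch G Z x n (y, m).
Proof.
move=> rx ry aqk aka kK aK mqk tak ca cq.
case: j ry => [|j] ry; first by move: tak; case/eqP: ry => _ ->; rewrite triC tri_tail.
have [w [mw [rw awa ema cw]]] := rch_inv ry.
have aak : adj G a k by rewrite cg_adj_sym.
rewrite ema in tak.
have [n [m [le r]]] := detour rw awa cw aK kK aak tak.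
have [|m' r'] := rch_join (rchS rx aqk cq) r.
  by rewrite mqk triC tri_tail (negbTE (KZ kK)).
by exists (i.+1 + n), m'; split=> //; clear - le; lia.
Qed.

(** A node [k] of the block is cut out of a route: [HK2] makes its neighbours equal or adjacent. The
    new edge usually has the same marks at [q] and [a] as the edges to [k]; where it may turn a
    triplex node into a nontriplex one, [bypass] avoids that node. *)
Lemma local_move x i q mq k a ma j y : rch G Z x i (q, mq) -> rch G Z y j (a, ma) ->
  adj G q k -> adj G k a -> k \in K -> a \notin K ->
  tri mq (mk G k q) = (q \in Z) -> tri ma (mk G k a) = (a \in Z) ->
  ~~ tri (mk G q k) (mk G a k) -> x \notin Z -> y \notin Z ->
  exists n m, n <= (i + j).+1 /\ rch G Z x n (y, m).
Proof.
move=> rx ry aqk aka kK aK cq ca ntk xZ yZ.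
have akq : adj G k q by rewrite cg_adj_sym.
have aak : adj G a k by rewrite cg_adj_sym.
have left_fix : mk G q k = Some false -> tri ma (mk G k a) ->
    exists n m, n <= (i + j).+1 /\ rch G Z x n (y, m).
  by move=> mqk t; apply: (bypass rx ry aqk aka kK aK mqk t).
have right_fix : q \notin K -> mk G a k = Some false -> tri mq (mk G k q) ->
    exists n m, n <= (i + j).+1 /\ rch G Z x n (y, m).
  move=> qK mak t.
  have [n [m [le r]]] := bypass ry rx aak akq kK qK mak t cq ca.
  have [m' r'] := rch_sym r xZ.
  by exists n, m'; split=> //; rewrite addnC.
have bridge : adj G q a -> tri mq (mk G a q) = (q \in Z) ->
    tri ma (mk G q a) = (a \in Z) -> exists n m, n <= (i + j).+1 /\ rch G Z x n (y, m).
  by move=> aqa t1 t2; have [m r] := rch_bridge rx ry aqa t1 t2; exists (i + j).+1, m.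
have qKZ : tri mq (mk G k q) -> q \notin K.
  by rewrite cq => qZ; apply/negP=> /KZ; rewrite qZ.
have [aq|aaq] : a = q \/ adj G a q by apply: (HK2 aK kK); rewrite // triC.
  have join : tri mq ma = (a \in Z) -> exists n m, n <= (i + j).+1 /\ rch G Z x n (y, m).
    move=> t; rewrite -aq in rx; have [m r] := rch_join rx ry t.
    by exists (i + j), m.
  rewrite -aq in cq ntk left_fix right_fix.
  case/or3P: (aka) => d.
  - have [t|/negbTE t] := boolP (tri ma (mk G k a)).
      by apply: left_fix => //; rewrite (mk_rid simG d).
    apply: join; rewrite -ca t; move: t; rewrite (mk_dir d).
    by case: (ma) => [[]|] // _; apply: tri_tail.
  - by move: ntk; rewrite (mk_dir d).
  - apply: join; rewrite -ca; move: cq; rewrite -ca (mk_und simG d).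
    by case: (mq) (ma) => [[]|] [[]|].
have aqa : adj G q a by rewrite cg_adj_sym.
case/or3P: (aqk) => dqk; case/or3P: (aka) => dka.
- have d : dir G q a by apply: (dir_closes cgG dqk (dir_connect dka)).
  by apply: bridge => //; rewrite -?cq -?ca ?(mk_dir d) ?(mk_rid simG d) ?(mk_dir dka) ?(mk_rid simG dqk).
- by move: ntk; rewrite (mk_dir dqk) (mk_dir dka).
- by move: ntk; rewrite (mk_dir dqk) (mk_dnu simG dka).
(* At a fork the orientation of the edge between [q] and [a] is not determined. If neither is a
   triplex node, both incoming marks are tails, and any orientation will do. *)
- have mqk := mk_rid simG dqk; have mak := mk_rid simG dka.
  have [t|/negbTE t] := boolP (tri ma (mk G k a)); first exact: left_fix.
  have [t'|/negbTE t'] := boolP (tri mq (mk G k q)); first by apply: right_fix => //; apply: qKZ.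
  apply: bridge => //; rewrite -?cq -?ca ?t ?t'.
    by move: t'; rewrite (mk_dir dqk); case: (mq) => [[]|] //; rewrite triC tri_tail.
  by move: t; rewrite (mk_dir dka); case: (ma) => [[]|] //; rewrite triC tri_tail.
- have d : dir G a q by apply: (dir_closes cgG dka (dir_connect dqk)).
  by apply: bridge => //; rewrite -?cq -?ca ?(mk_dir d) ?(mk_rid simG d) ?(mk_dir dqk) ?(mk_rid simG dka).
- have d : dir G a q.
    by apply: (closes_dir cgG (und_connect _) dqk); rewrite // cg_und_sym.
  have [t|/negbTE t] := boolP (tri ma (mk G k a)); first by apply: left_fix; rewrite ?(mk_rid simG dqk).
  apply: bridge => //; first by rewrite (mk_dir d) -cq (mk_dir dqk).
  by rewrite (mk_rid simG d) tri_tail -ca t.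
- have d : dir G q a by apply: (closes_dir cgG (und_connect dqk) dka).
  have [t|/negbTE t] := boolP (tri mq (mk G k q)).
    by apply: right_fix; rewrite ?(mk_rid simG dka) ?qKZ.
  apply: bridge => //; last by rewrite (mk_dir d) -ca (mk_dir dka).
  by rewrite (mk_rid simG d) tri_tail -cq t.
- by move: ntk; rewrite (mk_und simG dqk) (mk_dir dka).
- have d : und G q a by apply: (und_closes cgG (connect1 dqk) (connect1 dka)).
  apply: bridge => //; first by rewrite (mk_dnu simG d) -cq (mk_dnu simG dqk).
  by rewrite (mk_und simG d) -ca (mk_und simG dka).
Qed.

Lemma rch_gdel_inv y n v m : rch (gdel G K) Z y n (v, m) -> y \notin K ->
  v \notin K /\ rch G Z y n (v, m).
Proof.
move=> + yK; elim: n v m => [|n IH] v m; first by case/eqP=> -> ->; split=> //; apply: rch0.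
case/rch_inv=> u [mu [/IH[uK r]]]; rewrite adj_gdel => /and3P[_ vK auv].
rewrite !mk_gdel // => -> t; split=> //; exact: (rchS r auv t).
Qed.

(** Walking back from [y], the first node of [K] met is cut out by [local_move], which shortens the
    route. Only the start [x] cannot be cut out; then its neighbour [b] is returned, with the bound
    that lets [block_separated] descend. *)
Lemma unblock x y : x \notin Z -> y \notin Z -> y \notin K ->
  forall n m, rch G Z x n (y, m) ->
  (x \notin K /\ exists n' m', rch (gdel G K) Z y n' (x, m')) \/
  (x \in K /\ exists b j m', [/\ rch (gdel G K) Z y j (b, m'), b \notin K,
      adj G b x, tri m' (mk G x b) = (b \in Z) & j < n]).
Proof.
move=> xZ yZ yK; elim/ltn_ind=> n IHn m rn.
have walk i v mv j mj : rch G Z x i (v, mv) -> rch (gdel G K) Z y j (v, mj) ->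
    tri mv mj = (v \in Z) -> i + j = n -> v \notin K ->
  (x \notin K /\ exists n' m', rch (gdel G K) Z y n' (x, m')) \/
  (x \in K /\ exists b j m', [/\ rch (gdel G K) Z y j (b, m'), b \notin K,
      adj G b x, tri m' (mk G x b) = (b \in Z) & j < n]).
  elim: i v mv j mj => [|i IH] v mv j mj rv rj tv ij vK.
    by case/eqP: rv => <- _; left; split=> //; exists j, mj.
  have [u [mu [ru auv emv tu]]] := rch_inv rv.
  have avu : adj G v u by rewrite cg_adj_sym.
  have [uK|uK] := boolP (u \in K); last first.
    apply: (IH u mu j.+1 (mk G v u)) => //; last by rewrite addnS -addSn.
    rewrite -(mk_gdel G vK uK); apply: (rchS rj); first by rewrite adj_gdel uK vK.
    by rewrite mk_gdel // triC -emv.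
  case: i IH ij ru rv => [|i] IH ij ru rv.
    case/eqP: ru => ux _; right; rewrite -ux; split=> //.
    by exists v, j, mj; split=> //; [rewrite triC -emv|clear - ij; lia].
  have [p [mp [rp apu emu tp]]] := rch_inv ru.
  have [_ rj'] := rch_gdel_inv rj yK.
  have [||n' [m' [le r]]] := local_move rp rj' apu auv uK vK tp _ _ xZ yZ.
  - by rewrite triC -emv.
  - by rewrite -emu tu KZ.
  have n'n : n' < n by clear - le ij; lia.
  case: (IHn n' n'n m' r) => [|[xK [b [j' [mb [h1 h2 h3 h4 h5]]]]]]; first by left.
  by right; split=> //; exists b, j', mb; split=> //; apply: ltn_trans n'n.
by apply: (walk n y m 0 (Some false)); rewrite ?rch0 ?addn0 // tri_tail (negbTE yZ).
Qed.

(** The neighbour [b] given by [unblock] lies in [Z], so it is a triplex node; [detour] skips it and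
    yields a shorter open route between the same ends. *)
Lemma block_separated x y : x \in K -> y \notin K -> y \notin Z ->
  (forall b, b \notin K -> adj G b x -> b \in Z) ->
  forall n m, ~~ rch G Z x n (y, m).
Proof.
move=> xK yK yZ bZ; elim/ltn_ind=> n IHn m; apply/negP=> rn.
have xZ := KZ xK.
case: (unblock xZ yZ yK rn) => [[]|[_ [b [j [mb [rj bK abx tb jn]]]]]]; first by rewrite xK.
have [_ rj'] := rch_gdel_inv rj yK; rewrite bZ // in tb.
case: j rj rj' jn => [|j] rj rj' jn; first by move: tb; case/eqP: rj => _ ->; rewrite triC tri_tail.
have [w [mw [rw awb emb cw]]] := rch_inv rj'; rewrite emb in tb.
have [n' [m' [le r]]] := detour rw awb cw bK xK abx tb.
have [m'' r''] := rch_sym r xZ.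
have n'n : n' < n by clear - le jn; lia.
by have := IHn n' n'n m''; rewrite r''.
Qed.

End Block.
End AMPShortcuts.

(** * Graphs with the same triplexes *)

Section AMPGraphoid.
Variables (T : finType) (G : graph T).
Hypothesis cgG : is_CG G.

Lemma aopen_sym (Z : {set T}) : symmetric (aopen G Z).
Proof.
suff half x y : aopen G Z x y -> aopen G Z y x by move=> x y; apply/idP/idP; apply: half.
case/aopen_rch=> yZ [n [m r]]; have xZ := rch_start r yZ.
have [m' r'] := rch_sym cgG r yZ.
by apply/aopen_rch; split=> //; exists n, m'.
Qed.

Lemma aopen_refl (Z : {set T}) x : x \notin Z -> aopen G Z x x.
Proof. by move=> xZ; apply/aopen_rch; split=> //; exists 0, (Some false); apply: rch0. Qed.

(** Reaching a node does not test its own membership, so the first node of [D] on the route is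
    reached under both conditioning sets. *)
Lemma rch_switch (Z1 Z2 D : {set T}) x n v m :
  (forall u, u \notin D -> (u \in Z1) = (u \in Z2)) -> rch G Z1 x n (v, m) ->
  rch G Z2 x n (v, m) \/
  exists d n' m', [/\ d \in D, rch G Z1 x n' (d, m') & rch G Z2 x n' (d, m')].
Proof.
move=> ZD; elim: n v m => [|n IH] v m r; first by left.
have [u [mu [ru auv -> tu]]] := rch_inv r.
have [ru2|] := IH _ _ ru; last by right.
have [uD|/ZD uZ] := boolP (u \in D); first by right; exists u, n, mu.
by left; apply: rchS ru2 auv _; rewrite -uZ.
Qed.

(** No open route starts or ends in [C], so overlaps with [C] are harmless and the graphoid rules
    below carry no disjointness conditions. *)
Definition asep (C A B : {set T}) := forall a b, a \in A -> b \in B -> ~~ aopen G C a b.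

Lemma asep_sym C A B : asep C A B -> asep C B A.
Proof. by move=> s a b aB bA; rewrite aopen_sym; apply: s. Qed.

Lemma asepU C A B D : asep C A B -> asep C A D -> asep C A (B :|: D).
Proof. by move=> s1 s2 a b aA; rewrite inE => /orP[]; [apply: s1|apply: s2]. Qed.

Lemma asep_sub (C A B A' B' : {set T}) : A' \subset A -> B' \subset B -> asep C A B -> asep C A' B'.
Proof. by move=> /subsetP sA /subsetP sB s a b /sA aA /sB bB; apply: s. Qed.

Lemma asep_contraction C A B D : asep (C :|: D) A B -> asep C A D -> asep C A B.
Proof.
move=> sB sD a b aA bB; apply/negP=> /aopen_rch[bC [n [m r]]].
have agree u : u \notin D :\: C -> (u \in C) = (u \in C :|: D).
  by rewrite !inE; case: (u \in C) => //=; move/negbTE=> ->.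
case: (rch_switch agree r) => [r'|[d [n' [m' [dD r1 _]]]]].
  have [bD|bD] := boolP (b \in D).
    by have /negP[] := sD a b aA bD; apply/aopen_rch; split=> //; exists n, m.
  have /negP[] := sB a b aA bB; apply/aopen_rch; split; last by exists n, m.
  by rewrite inE negb_or bC.
move: dD; rewrite inE => /andP[dC dD].
by have /negP[] := sD a d aA dD; apply/aopen_rch; split=> //; exists n', m'.
Qed.

Lemma asep_weak_union C A B D : asep C A (B :|: D) -> asep (C :|: D) A B.
Proof.
move=> s a b aA bB; apply/negP=> /aopen_rch[].
rewrite inE negb_or => /andP[bC bD] [n [m r]].
have agree u : u \notin D :\: C -> (u \in C :|: D) = (u \in C).
  by rewrite !inE; case: (u \in C) => //=; move/negbTE=> ->.
case: (rch_switch agree r) => [r'|[d [n' [m' [dD _ r2]]]]].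
  have bBD : b \in B :|: D by rewrite inE bB.
  by have /negP[] := s a b aA bBD; apply/aopen_rch; split=> //; exists n, m.
move: dD; rewrite inE => /andP[dC dD].
have dBD : d \in B :|: D by rewrite inE dD orbT.
by have /negP[] := s a d aA dBD; apply/aopen_rch; split=> //; exists n', m'.
Qed.

End AMPGraphoid.

(** * Terminal blocks *)

Section TopBlock.
Variables (T : finType) (H : graph T).
Hypothesis cgH : is_CG H.

Definition terminal_block (K : {set T}) :=
  [/\ forall k k', k \in K -> k' \in K -> adj H k k' -> und H k k'
    & forall u k, u \notin K -> k \in K -> adj H u k -> dir H u k].

(** Among the nodes reachable from [v], one with the fewest reachable nodes is reachable back from
    each of them; these nodes form the block. *)
Lemma terminal_block_above v : exists2 K : {set T}, terminal_block K &
  (exists k, k \in K) /\ forall k, k \in K -> connect (semi H) v k.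
Proof.
pose up k := [set w | connect (semi H) k w].
have vv : connect (semi H) v v by exact: connect0.
case: (arg_minnP (fun k => #|up k|) vv) => k0 vk0 min.
have back k : k \in up k0 -> connect (semi H) k k0.
  rewrite inE => k0k.
  have sub : up k \subset up k0.
    by apply/subsetP=> w; rewrite !inE; apply: connect_trans k0k.
  have /eqP e : up k == up k0.
    by rewrite eqEcard sub /=; apply: min; apply: connect_trans vk0 k0k.
  suff: k0 \in up k by rewrite inE.
  by rewrite e inE connect0.
have closed k w : k \in up k0 -> semi H k w -> w \in up k0.
  by rewrite !inE => k0k kw; apply: connect_trans k0k (connect1 kw).
exists (up k0); last first.
  split=> [|k]; first by exists k0; rewrite inE connect0.
  by rewrite inE; apply: connect_trans vk0.
split=> [k k' kK k'K|u k uK kK].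
  have nd a b : a \in up k0 -> b \in up k0 -> dir H a b -> False.
    move=> aK bK d; apply: (cg_no_cycle cgH d); apply: connect_trans (back b bK) _.
    by rewrite inE in aK.
  by case/or3P=> // d; [case: (nd k k')|case: (nd k' k)].
have nsemi : ~ semi H k u by move=> s; case/negP: uK; apply: closed kK s.
case/or3P=> // d; case: nsemi; rewrite /semi ?d //.
by rewrite cg_und_sym // d orbT.
Qed.

End TopBlock.

Definition same_triplexes (T : finType) (G H : graph T) :=
  forall a b c, adj G a b -> adj G b c -> a <> c -> ~~ adj G a c ->
    tri (mk G a b) (mk G c b) = tri (mk H a b) (mk H c b).

Section AMPStep.
Variables (T : finType) (G H : graph T).
Hypotheses (cgG : is_CG G) (cgH : is_CG H).
Hypothesis adjE : adj G =2 adj H.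
Hypothesis triE : same_triplexes G H.
Let simG := cg_simple cgG.
Let simH := cg_simple cgH.

Lemma same_triplexes_gdel K : same_triplexes (gdel G K) (gdel H K).
Proof.
move=> a b c; rewrite !adj_gdel => /and3P[aK bK ab] /and3P[_ cK bc] ac.
by rewrite aK cK /= => nac; rewrite !mk_gdel //; apply: triE.
Qed.

Section Block.
Variable K : {set T}.
Hypothesis KH : terminal_block H K.

Let KH1 k k' : k \in K -> k' \in K -> adj G k k' -> und H k k'.
Proof. by move=> kK k'K; rewrite adjE; case: KH => + _; apply. Qed.

Let KH2 u k : u \notin K -> k \in K -> adj G u k -> dir H u k.
Proof. by move=> uK kK; rewrite adjE; case: KH => _; apply. Qed.

Let adjC : symmetric (adj G) := cg_adj_sym cgG.

(** This supplies [HK1]: unshielded, the triplex would also be one of [H], where [u] has a tail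
    towards [k]. *)
Lemma block_tail c u k : u \notin K -> k \in K -> adj G c u -> adj G u k ->
  tri (mk G c u) (mk G k u) -> c = k \/ adj G c k.
Proof.
move=> uK kK cu uk; case: (eqVneq c k) => [->|/eqP ck]; first by left.
case: (boolP (adj G c k)) => [_|nck]; first by right.
rewrite (triE cu uk ck nck) (mk_rid simH (KH2 uK kK uk)).
by rewrite tri_tail.
Qed.

(** This supplies [HK2]: in [H] the arrow from [a] makes a triplex at [k] with any other edge there,
    since no arrow of [H] leaves [K]. *)
Lemma block_triplex a k q : a \notin K -> k \in K -> adj G a k -> adj G k q ->
  ~~ tri (mk G a k) (mk G q k) -> a = q \/ adj G a q.
Proof.
move=> aK kK ak kq; case: (eqVneq a q) => [->|/eqP aq]; first by left.
case: (boolP (adj G a q)) => [_|naq]; first by right.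
rewrite (triE ak kq aq naq) (mk_dir (KH2 aK kK ak)).
have [qK|qK] := boolP (q \in K).
  by rewrite (mk_und simH (KH1 qK kK _)) // adjC.
by rewrite (mk_dir (KH2 qK kK _)) // adjC.
Qed.

(** In [H] the node [u] has two undirected edges to [w] and [v], or tails towards both, and neither
    makes a triplex. *)
Lemma block_collider w u v : w \in K -> v \in K -> adj G w u -> adj G u v ->
  tri (mk G w u) (mk G v u) -> w = v \/ adj G w v.
Proof.
move=> wK vK wu uv; case: (eqVneq w v) => [->|/eqP wv]; first by left.
case: (boolP (adj G w v)) => [_|nwv]; first by right.
have [uK|uK] := boolP (u \in K).
  rewrite (triE wu uv wv nwv) (mk_und simH (KH1 wK uK wu)).
  by rewrite (mk_dnu simH (KH1 uK vK uv)).
by rewrite (triE wu uv wv nwv) (mk_rid simH (KH2 uK vK uv)) tri_tail.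
Qed.

(** If no shorter shield is present, the triplexes at [w] and at [u] are unshielded and survive in
    [H]. The first forces [w] into [K] and [u] outside, with an arrow from [u] to [w]; its tail at
    [u] contradicts the second. *)
Lemma block_biflag t w u v : t \in K -> v \in K -> dir G t w -> und G w u ->
  dir G v u -> t = v \/ adj G t v.
Proof.
move=> tK vK tw wu vu.
have atw : adj G t w by rewrite /adj tw.
have awu : adj G w u by rewrite /adj wu !orbT.
have auv : adj G u v by rewrite /adj vu orbT.
have auw : adj G u w by rewrite adjC.
have [tu|ntu] := boolP (adj G t u).
  have dtu : dir G t u by apply: (dir_closes cgG tw (und_connect wu)).
  by apply: (block_collider tK vK tu auv); rewrite (mk_dir dtu) (mk_dir vu).
have ntu' : t <> u by move=> e; rewrite e in tw; rewrite (dir_und' cgG tw) in wu.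
have := triE atw awu ntu' ntu; rewrite (mk_dir tw) (mk_dnu simG wu).
have [wK|wK] := boolP (w \in K); last by rewrite triC (mk_rid simH (KH2 wK tK _)) ?tri_tail // adjC.
rewrite (mk_und simH (KH1 tK wK atw)).
have [uK|uK] := boolP (u \in K); first by rewrite (mk_und simH (KH1 uK wK auw)).
have duw := KH2 uK wK auw; move=> _.
have [wv|nwv] := boolP (adj G w v).
  have avw : adj G v w by rewrite adjC.
  have dvw : dir G v w.
    by apply: (dir_closes cgG vu _ avw); apply: und_connect; rewrite cg_und_sym.
  by apply: (block_collider tK vK atw wv); rewrite (mk_dir tw) (mk_dir dvw).
have nwv' : w <> v by move=> e; rewrite -e in vu; rewrite (dir_und cgG vu) in wu.
have := triE awu auv nwv' nwv; rewrite (mk_und simG wu) (mk_dir vu) (mk_rid simH duw).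
by rewrite [tri (Some false) _]triC tri_tail.
Qed.

Section Cut.
Variable S0 : {set T}.
Let link := fun a b => [&& a \in K :\: S0, b \in K :\: S0 & adj G a b].

(** Nodes outside [K :\: S0] are conditioned on, so they must be triplex nodes. Two consecutive ones
    are joined by an undirected edge, hence there are never three in a row, and [block_collider] and
    [block_biflag] cover the excursions. *)
Lemma open_link x0 n v m : rch G (~: K :|: S0) x0 n (v, m) ->
  x0 \in K :\: S0 -> v \in K :\: S0 -> connect link x0 v.
Proof.
set C := ~: K :|: S0.
have inC u : (u \in C) = (u \notin K :\: S0).
  by rewrite !inE negb_and negbK orbC.
move=> + x0K; elim/ltn_ind: n v m => n IH v m rv vK.
case: n IH rv => [|n] IH rv; first by case/eqP: rv => -> _; apply: connect0.
have [u [mu [ru auv _ tu]]] := rch_inv rv.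
have [uC|uK] := boolP (u \in C); last first.
  rewrite inC negbK in uK.
  by apply: connect_trans (IH n _ _ _ ru uK) (connect1 _); rewrite ?ltnS // /link uK vK.
rewrite uC in tu; case: n IH ru rv => [|n] IH ru rv.
  by case/eqP: ru tu => _ ->; rewrite triC tri_tail.
have [w [mw [rw awu emu tw]]] := rch_inv ru.
have fin n' t m' : n' < n.+2 -> rch G C x0 n' (t, m') -> t \in K :\: S0 ->
    t = v \/ adj G t v -> connect link x0 v.
  move=> lt rt tK; have := IH n' lt t m' rt tK => ct [<- //|atv].
  by apply: connect_trans ct (connect1 _); rewrite /link tK vK.
have vK' : v \in K by case/setDP: vK.
have [wC|wK] := boolP (w \in C); last first.
  rewrite inC negbK in wK; apply: (fin n w mw) => //.
  have wK' : w \in K by case/setDP: wK.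
  by apply: (block_collider wK' vK' awu auv); rewrite -emu.
rewrite wC in tw; rewrite emu in tu.
have duw : und G w u.
  case/or3P: awu => // d; first by move: tw; rewrite (mk_rid simG d) tri_tail.
  by move: tu; rewrite (mk_rid simG d) triC tri_tail.
case: n IH ru rv rw fin => [|n] IH ru rv rw fin.
  by case/eqP: rw tw => _ ->; rewrite triC tri_tail.
have [t [mt [rt atw emw tt]]] := rch_inv rw.
have dvu : dir G v u.
  case/or3P: auv => // d; first by move: tu; rewrite (mk_rid simG d) tri_tail.
  by move: tu; rewrite (mk_und simG duw) (mk_dnu simG d).
have dtw : dir G t w.
  case/or3P: atw emw => // d; move=> e; move: tw; rewrite e.
    by rewrite (mk_rid simG d) triC tri_tail.
  by rewrite (mk_und simG d) (mk_dnu simG duw).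
have tK : t \in K :\: S0.
  by rewrite -[_ \in _]negbK -inC -tt (mk_rid simG dtw) tri_tail.
apply: (fin n t mt) => //; first exact: ltnW.
have tK' : t \in K by case/setDP: tK.
exact: (block_biflag tK' vK' dtw duw dvu).
Qed.

End Cut.

(** * One AMP peeling step *)

Section Peel.
Variables (Z : {set T}) (x y : T).
Hypothesis IH : forall Z' a b, aopen (gdel G K) Z' a b -> aopen (gdel H K) Z' a b.
Hypothesis nxy : ~~ aopen H Z x y.
Hypotheses (xZ : x \notin Z) (yZ : y \notin Z).

Let S : {set T} := K :&: (Z :|: [set x; y]).
(* The nodes outside the block that matter: [x], [y] and the parents in [H] of [S]. *)
Let relevant v := [&& v \notin K, v \notin Z &
  [|| v == x, v == y | [exists s, (s \in S) && adj G v s]]].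
(** The relevant nodes are divided according to whether [H] connects them to [x]. The nodes of [K]
    in [Z] follow their parents into [SX] or [SY], or into [S0] when all parents are conditioned
    on. *)
Let X1 : {set T} := [set v | relevant v && aopen H Z x v].
Let Y1 : {set T} := [set v | relevant v && ~~ aopen H Z x v].
Let S0 : {set T} := [set s in K :&: Z |
  [forall p, (p \notin K) && adj G p s ==> (p \in Z)]].
Let SX : {set T} := [set s in K | (s == x) ||
  ((s \in Z) && [exists p, (p \in X1) && adj G p s])].
Let SY : {set T} := [set s in K | (s == y) ||
  ((s \in Z) && [exists p, (p \in Y1) && adj G p s])].
Let Zn : {set T} := Z :\: K.

Let adjHC a b : adj G a b -> adj H a b. Proof. by rewrite adjE. Qed.
Let adjHs a b : adj G a b -> adj H b a. Proof. by rewrite adjC adjE. Qed.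

Let aopenI v n m : rch H Z x n (v, m) -> v \notin Z -> aopen H Z x v.
Proof. by move=> r vZ; apply/aopen_rch; split=> //; exists n, m. Qed.

Let relevantI v s : v \notin K -> v \notin Z -> s \in S -> adj G v s -> relevant v.
Proof.
move=> vK vZ sS vs; rewrite /relevant vK vZ /=; apply/or3P; apply: Or33.
by apply/existsP; exists s; rewrite sS.
Qed.

Let into p s : aopen H Z x p -> p \notin K -> s \in K -> adj G p s ->
  exists n, rch H Z x n (s, Some true).
Proof.
case/aopen_rch=> pZ [n [m r]] pK sK ps; have d := KH2 pK sK ps.
exists n.+1; rewrite -(mk_dir d); apply: rchS r (adjHC ps) _.
by rewrite (mk_rid simH d) tri_tail (negbTE pZ).
Qed.

Let through p s p' : aopen H Z x p -> p \notin K -> s \in K -> s \in Z ->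
  adj G p s -> p' \notin K -> adj G p' s ->
  exists n, rch H Z x n (p', Some false).
Proof.
move=> op pK sK sZ ps p'K p's; have [n r] := into op pK sK ps.
have d := KH2 p'K sK p's.
exists n.+1; rewrite -(mk_rid simH d); apply: rchS r (adjHs p's) _.
by rewrite (mk_dir d) sZ.
Qed.

Let X1P v : v \in X1 -> [/\ v \notin K, v \notin Z, relevant v & aopen H Z x v].
Proof. by rewrite inE => /andP[r ->]; split=> //; case/and3P: r. Qed.

Let Y1P v : v \in Y1 -> [/\ v \notin K, v \notin Z, relevant v & ~~ aopen H Z x v].
Proof. by rewrite inE => /andP[r ->]; split=> //; case/and3P: r. Qed.

Let relXY v : relevant v -> v \notin X1 -> v \in Y1.
Proof. by rewrite !inE => -> /=. Qed.

Let SS s : s \in K -> s \in Z -> s \in S. Proof. by rewrite !inE => -> ->. Qed.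

Let S0P s : s \in S0 -> [/\ s \in K, s \in Z &
  forall p, p \notin K -> adj G p s -> p \in Z].
Proof.
rewrite !inE => /andP[/andP[sK sZ] /forallP h]; split=> // p pK ps.
by have := h p; rewrite pK ps.
Qed.

(** A parent of a node of [SX] is connected to [x] through that node, which is [x] itself or a
    collider in [Z]. *)
Let SX_parent s p : s \in SX :|: S0 -> p \notin K -> p \notin Z -> adj G p s -> p \in X1.
Proof.
move=> + pK pZ ps; rewrite inE => /orP[|/S0P[_ _ /(_ p pK ps)]]; last by rewrite (negbTE pZ).
rewrite inE => /andP[sK /orP[/eqP sx|/andP[sZ /existsP[p' /andP[/X1P[p'K p'Z _ op'] p's]]]]].
  rewrite inE (@relevantI p s) //; last by rewrite !inE sK sx eqxx orbT.
  apply: (@aopenI _ 1 (mk H x p)) => //; apply: (rchS (rch0 H Z x)).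
    by rewrite -sx; apply: adjHs.
  by rewrite triC tri_tail (negbTE xZ).
rewrite inE (@relevantI p s) ?SS //; have [n r] := through op' p'K sK sZ p's pK ps.
exact: aopenI r pZ.
Qed.

Let SY_parent s p : s \in SY :|: S0 -> p \notin K -> p \notin Z -> adj G p s -> p \in Y1.
Proof.
move=> + pK pZ ps; rewrite inE => /orP[|/S0P[_ _ /(_ p pK ps)]]; last by rewrite (negbTE pZ).
rewrite inE => /andP[sK sY].
have sS : s \in S by rewrite !inE sK; case/orP: sY => [->|/andP[-> _]]; rewrite ?orbT.
have rp := relevantI pK pZ sS ps.
apply: relXY => //; apply/negP=> /X1P[_ _ _ op].
case/orP: sY => [/eqP sy|/andP[sZ /existsP[p' /andP[/Y1P[p'K p'Z _ no] p's]]]].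
  by have [n r] := into op pK sK ps; rewrite sy in r; case/negP: nxy; apply: aopenI r yZ.
have [n r] := through op pK sK sZ ps p'K p's; case/negP: no; exact: aopenI r p'Z.
Qed.

Let Z_split s : s \in K -> s \in Z -> [|| s \in S0, s \in SX | s \in SY].
Proof.
move=> sK sZ; have [//|/=] := boolP (s \in S0).
rewrite !inE sK sZ /= negb_forall => /existsP[p]; rewrite negb_imply => /andP[/andP[pK ps] pZ].
have rp : relevant p by apply: relevantI ps => //; apply: SS.
have [pX|/(relXY rp) pY] := boolP (p \in X1).
  by apply/orP; left; apply/orP; right; apply/existsP; exists p; rewrite pX.
by apply/orP; right; apply/orP; right; apply/existsP; exists p; rewrite pY.
Qed.

(** [unblock] moves an open route out of the block, the induction hypothesis carries it to [H], and
    there it extends a route from [x]. *)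
Let X1Y1 : asep G Zn X1 Y1.
Proof.
move=> a b aX bY; apply/negP=> o.
have [aK aZ ra oa] := X1P aX; have [bK bZ rb /negP ob] := Y1P bY.
have KZn k : k \in K -> k \notin Zn by rewrite !inE => ->.
have xn : a \notin Zn by rewrite inE negb_and aZ orbT.
have [bn [n [m r]]] := (proj1 (aopen_rch _ _ _ _) o).
have del : aopen (gdel G K) Zn a b.
  case: (unblock cgG KZn block_tail block_triplex xn bn bK r) => [[_ [n' [m' r']]]|[]].
    have [m'' r''] := rch_sym (gdel_CG K cgG) r' xn.
    by apply/aopen_rch; split=> //; exists n', m''.
  by rewrite (negbTE aK).
have [_ [n' [m' r']]] := (proj1 (aopen_rch _ _ _ _) (IH del)).
have rZ : forall n m v, rch (gdel H K) Zn a n (v, m) -> v \notin K /\ rch H Z a n (v, m).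
  elim=> [|i IHi] mv v; first by case/eqP=> -> ->; split=> //; apply: rch0.
  case/rch_inv=> u [mu [/IHi[uK ru]]]; rewrite adj_gdel => /and3P[_ vK auv].
  rewrite !mk_gdel // => -> tu; split=> //; apply: (rchS ru) => //.
  by rewrite tu inE uK.
have [_ {}r'] := rZ _ _ _ r'.
(* Arriving at [a] with a tail gives the state of a fresh start, so the route to [b] can be
   appended. When [a] is a parent of some [s] in [Z], the tail is obtained by going from [a] to [s]
   and back. *)
have glue i : rch H Z x i (a, Some false) -> False.
  move=> ri; apply: ob; apply/andP; split=> //; apply/existsP; exists m'.
  apply: (@connect_trans _ _ (a, Some false)); apply/rch_connect; first by exists i.
  by exists n'.
case/and3P: ra => _ _ /or3P[/eqP ax|/eqP ay|/existsP[s /andP[sS as_]]].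
- by apply: (glue 0); rewrite ax; apply: rch0.
- by rewrite ay (negbTE nxy) in oa.
have sK : s \in K by move: sS; rewrite inE => /andP[].
have das := KH2 aK sK as_.
have [sZ|sZ] := boolP (s \in Z).
  by have [i ri] := through oa aK sK sZ as_ aK as_; apply: glue ri.
move: sS; rewrite !inE sK (negbTE sZ) /= => /orP[]/eqP sE; rewrite sE in as_ das.
  apply: (glue 1); rewrite -(mk_rid simH das); apply: (rchS (rch0 H Z x)); first exact: adjHs.
  by rewrite triC tri_tail (negbTE xZ).
have yK : y \in K by rewrite -sE.
have [i ri] := into oa aK yK as_; case/negP: nxy; exact: aopenI ri yZ.
Qed.

Let block_sep (C U W : {set T}) : (forall k, k \in K -> k \notin C) -> U \subset K ->
  (forall w, w \in W -> w \notin K) ->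
  (forall s p, s \in U -> p \notin K -> adj G p s -> p \in C) -> asep G C U W.
Proof.
move=> KC /subsetP UK WK par s w sU wW; apply/negP=> /aopen_rch[wC [n [m r]]].
have := block_separated cgG KC block_tail block_triplex (UK _ sU) (WK _ wW) wC _ n m.
by rewrite r => /(_ (fun b bK => par s b sU bK)).
Qed.

(** By [open_link], a connection would be a path in [K :\: S0], which is undirected in [H].
    Reachability from [x] in [H] propagates along it: a node met in [Z] has a parent outside [Z],
    which is then reached too, so the node belongs to [SX]. *)
Let SXSY : asep G (~: K :|: S0) SX SY.
Proof.
move=> a b aX bY; apply/negP=> /aopen_rch[bC [n [m r]]].
have aC := rch_start r bC.
have inC u : u \in K -> u \notin ~: K :|: S0 -> u \in K :\: S0.
  by rewrite !inE => -> /=; rewrite andbT.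
have aK : a \in K by move: aX; rewrite inE => /andP[].
have bK : b \in K by move: bY; rewrite inE => /andP[].
have /connectP[p pp e] := open_link r (inC _ aK aC) (inC _ bK bC).
pose good v := v \in SX \/ v \notin Z /\ exists n, rch H Z x n (v, None).
have stepG u v : good u -> [&& u \in K :\: S0, v \in K :\: S0 & adj G u v] -> good v.
  move=> gu /and3P[/setDP[uK uS0] /setDP[vK vS0] uv].
  have uuv := KH1 uK vK uv.
  have [n' rv] : exists n', rch H Z x n' (v, None).
    case: gu => [|[uZ [i ri]]]; last first.
      exists i.+1; rewrite -(mk_und simH uuv); apply: rchS ri (adjHC uv) _.
      by rewrite (mk_dnu simH uuv) (negbTE uZ).
    rewrite inE uK /= => /orP[/eqP ux|/andP[uZ /existsP[p' /andP[/X1P[p'K _ _ op] p'u]]]].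
      exists 1; rewrite -(mk_und simH uuv) ux; apply: (rchS (rch0 H Z x)); first by rewrite -ux; apply: adjHC.
      by rewrite triC tri_tail (negbTE xZ).
    have [i ri] := into op p'K uK p'u.
    exists i.+1; rewrite -(mk_und simH uuv); apply: rchS ri (adjHC uv) _.
    by rewrite (mk_dnu simH uuv) uZ.
  have [vZ|vZ] := boolP (v \in Z); last by right; split=> //; exists n'.
  left; move: vS0; rewrite !inE vK vZ /= negb_forall => /existsP[p'].
  rewrite negb_imply => /andP[/andP[p'K p'v] p'Z].
  apply/orP; right; apply/existsP; exists p'; rewrite p'v andbT inE.
  rewrite (relevantI p'K p'Z (SS vK vZ) p'v) /=.
  have d := KH2 p'K vK p'v.
  by apply: (aopenI (rchS rv (adjHs p'v) _)) => //; rewrite (mk_dir d) vZ.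
have gb : good b.
  rewrite e; have: good a by left.
  elim: p a pp {aX aC aK r e bK bC bY} => //= v p IHp a /andP[av pp] ga.
  by apply: (IHp v pp); apply: stepG av.
move: bY; rewrite inE bK /= => /orP[/eqP by_|/andP[bZ /existsP[p' /andP[p'Y p'b]]]].
  case: gb => [|[_ [n' r']]]; last by case/negP: nxy; rewrite -by_; apply: aopenI r' _; rewrite by_.
  rewrite inE by_ (negbTE yZ) orbF => /andP[_ /eqP yx].
  by case/negP: nxy; rewrite yx aopen_refl.
have [p'K p'Z _ /negP no] := Y1P p'Y.
case: gb => [bX|[]]; last by rewrite bZ.
have : p' \in X1 by apply: (SX_parent _ p'K p'Z p'b); rewrite inE bX.
by case/X1P.
Qed.

Lemma peel_separated : ~~ aopen G Z x y.
Proof.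
have xX : x \in X1 :|: SX.
  rewrite !inE eqxx /= ?andbT; have [xK|xK] := boolP (x \in K); first by rewrite orbT.
  by rewrite /relevant xK xZ eqxx aopen_refl.
have yY : y \in Y1 :|: SY.
  rewrite !inE eqxx /= ?andbT; have [yK|yK] := boolP (y \in K); first by rewrite orbT.
  by rewrite /relevant yK yZ eqxx nxy orbT.
have subK (A : {set T}) : A \subset K -> A :|: S0 \subset K.
  by move=> AK; rewrite subUset AK; apply/subsetP=> s /S0P[].
have SXK : SX \subset K by apply/subsetP=> s; rewrite inE => /andP[].
have SYK : SY \subset K by apply/subsetP=> s; rewrite inE => /andP[].
have ZnK k : k \in K -> k \notin Zn by rewrite !inE => ->.
(* [Y2] completes [Zn :|: X1] to the complement of [K], so contraction over it removes the surplus
   conditioning of [SXSY]. *)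
pose Y2 : {set T} := [set v | [&& v \notin K, v \notin Z & v \notin X1]].
have Y12 : Y1 \subset Y2.
  apply/subsetP=> v vY; have [vK vZ _ no] := Y1P vY; rewrite inE vK vZ /=.
  by apply/negP=> /X1P[_ _ _]; rewrite (negbTE no).
have s2 : asep G (Zn :|: Y1) X1 (SY :|: S0).
  apply: asep_sym => //; apply: block_sep (subK _ SYK) _ _.
  - by move=> k kK; rewrite inE negb_or ZnK //; apply/negP=> /Y1P[]; rewrite kK.
  - by move=> w /X1P[].
  move=> s p sS pK ps; rewrite !inE pK /=; have [//|pZ] := boolP (p \in Z).
  by have := SY_parent sS pK pZ ps; rewrite inE.
have s3 : asep G (Zn :|: S0) X1 (Y1 :|: SY).
  apply: asep_weak_union; rewrite -setUA; apply: asepU; first exact: X1Y1.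
  by apply: (asep_contraction s2); apply: X1Y1.
have s4 : asep G (Zn :|: X1 :|: S0) SX Y2.
  apply: asep_sym => //; apply: asep_weak_union; apply: asep_sym => //.
  apply: block_sep (subK _ SXK) _ _.
  - by move=> k kK; rewrite inE negb_or ZnK //; apply/negP=> /X1P[]; rewrite kK.
  - by move=> w; rewrite inE => /and3P[].
  move=> s p sS pK ps; rewrite !inE pK /=; have [//|pZ] := boolP (p \in Z).
  by have := SX_parent sS pK pZ ps; rewrite inE.
have s5 : asep G (Zn :|: X1 :|: S0) SX (Y1 :|: SY).
  apply: asepU; first by apply: asep_sub s4.
  apply: asep_contraction s4.
  have -> : Zn :|: X1 :|: S0 :|: Y2 = ~: K :|: S0; last exact: SXSY.
  apply/setP=> v; rewrite 3!inE [RHS]inE [v \in ~: K]inE [v \in Zn]inE [v \in Y2]inE.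
  have [vK|vK] /= := boolP (v \in K); last by case: (v \in Z); case: (v \in X1); rewrite ?orbT.
  by have /negbTE-> : v \notin X1 by [apply/negP=> /X1P[]; rewrite vK]; rewrite orbF.
have s6 : asep G (Zn :|: S0) (Y1 :|: SY) (X1 :|: SX).
  apply: asepU; first exact: asep_sym.
  apply: (@asep_contraction _ _ _ _ _ X1); last exact: asep_sym.
  by rewrite setUAC; apply: asep_sym.
(* Weak union now moves [SX] and [SY], apart from [x] and [y], to the conditioning set, which
   thereby becomes [Z]. *)
have s7 : asep G (Zn :|: S0 :|: SX :\ x) (Y1 :|: SY) [set x].
  apply: asep_weak_union; apply: asep_sub s6 => //.
  by rewrite subUset sub1set xX; apply: subset_trans (subsetDl _ _) (subsetUr _ _).
have s8 : asep G (Zn :|: S0 :|: SX :\ x :|: SY :\ y) [set x] [set y].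
  apply: asep_weak_union; apply: asep_sym => //; apply: asep_sub s7 => //.
  by rewrite subUset sub1set yY; apply: subset_trans (subsetDl _ _) (subsetUr _ _).
have <- : Zn :|: S0 :|: SX :\ x :|: SY :\ y = Z.
  apply/setP=> s; apply/idP/idP.
    rewrite 3!inE => /orP[/orP[/orP[|/S0P[]//]|]|].
    - by rewrite inE => /andP[].
    - by rewrite !inE => /and3P[/negbTE-> _ /= /andP[]].
    - by rewrite !inE => /and3P[/negbTE-> _ /= /andP[]].
  move=> sZ; rewrite 3!inE; have [sK|sK] := boolP (s \in K); last by rewrite inE sK sZ.
  have sx : s != x by apply: contra xZ => /eqP<-.
  have sy : s != y by apply: contra yZ => /eqP<-.
  rewrite [s \in SX :\ x]inE [s \in SY :\ y]inE [s \in [set x]]inE [s \in [set y]]inE sx sy /=.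
  by have := Z_split sK sZ; case: (s \in S0); case: (s \in SX); case: (s \in SY); rewrite ?orbT.
by apply: s8; rewrite inE.
Qed.

End Peel.
End Block.
End AMPStep.

Theorem aopen_transfer (T : finType) (G H : graph T) :
  is_CG G -> is_CG H -> adj G =2 adj H -> same_triplexes G H ->
  forall Z x y, aopen G Z x y -> aopen H Z x y.
Proof.
(* A deleted block stays in the type as isolated nodes, so the measure counts the nonisolated nodes;
   the block is chosen above one of these to make it drop. *)
pose busy (G : graph T) : {set T} := [set v | [exists w, adj G v w]].
move: {2}_.+1 (ltnSn #|busy G|) => n.
elim: n G H => // n IHn G H busyn cgG cgH adjE triE Z x y oG.
have [/existsP[v vb]|/existsPn none] := boolP [exists v, v \in busy G]; last first.
  case/aopen_rch: (oG) => yZ [[|i] [m r]].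
    by case/eqP: r => <- _; apply: aopen_refl.
  have [u [_ [_ auy _ _]]] := rch_inv r.
  by have /negP[] := none u; rewrite inE; apply/existsP; exists y.
have [K KH [[k kK] Kv]] := terminal_block_above cgH v.
have kb : k \in busy G.
  have := Kv k kK; case/connectP=> p; case: (lastP p) => [_ /= -> //|p' w].
  rewrite rcons_path last_rcons => /andP[_ st] ->; rewrite inE; apply/existsP.
  exists (last v p'); rewrite adjE cg_adj_sym //; exact: semi_adj.
apply/negPn/negP=> nH.
have [yZ _] := proj1 (aopen_rch _ _ _ _) oG.
have xZ : x \notin Z by have := oG; rewrite aopen_sym // => /aopen_rch[].
have smaller : #|busy (gdel G K)| < n.
  apply: leq_trans (_ : _ <= #|busy G|) _; last by rewrite -ltnS.
  apply: proper_card; apply/properP; split; last first.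
    exists k => //; rewrite inE; apply/existsPn=> w; by rewrite adj_gdel kK.
  apply/subsetP=> u; rewrite !inE => /existsP[w]; rewrite adj_gdel => /and3P[_ _ uw].
  by apply/existsP; exists w.
have adjE' : adj (gdel G K) =2 adj (gdel H K) by move=> a b; rewrite !adj_gdel adjE.
have IH Z' a b : aopen (gdel G K) Z' a b -> aopen (gdel H K) Z' a b.
  by apply: (IHn _ _ smaller) => //; [apply: gdel_CG|apply: gdel_CG|apply: same_triplexes_gdel].
by case/negP: (peel_separated cgG cgH adjE triE KH IH nH xZ yZ).
Qed.

(** * Moral graphs *)

Lemma lstepP (T : finType) (G : graph T) (Z : {set T}) v s v' s' :
  lstep G Z (v, s) (v', s') <->
  [\/ [/\ und G v v', s = None -> v' \notin Z &
         s' = if s is Some b then Some (b || (v' \in Z)) else None],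
      [/\ dir G v' v, s <> Some false, s' = None & v' \notin Z]
    | [/\ dir G v v', s <> Some true & s' = Some (v' \in Z)]].
Proof.
rewrite /lstep; split.
  case/or3P=> [/and3P[u /implyP h /eqP e]|/and4P[d /eqP h /eqP e n]|/and3P[d /eqP h /eqP e]].
  - by apply: Or31; split=> // sN; apply: h; rewrite sN.
  - by apply: Or32.
  - by apply: Or33.
case=> [[u h e]|[d h e n]|[d h e]]; apply/or3P.
- by apply: Or31; apply/and3P; split=> //; [apply/implyP=> /eqP|apply/eqP].
- by apply: Or32; apply/and4P; split=> //; apply/eqP.
- by apply: Or33; apply/and3P; split=> //; apply/eqP.
Qed.

Section Moral.
Variables (T : finType) (G : graph T).

Definition ind (W : {set T}) := gdel G (~: W).

Definition undin (W : {set T}) : rel T := fun u v => [&& u \in W, v \in W & und G u v].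

(* [a] and [c] have children in a common undirected component of [W]. *)
Definition via (W : {set T}) (a c : T) : bool :=
  [exists b, exists b', [&& b \in W, b' \in W, dir G a b, dir G c b' & connect (undin W) b b']].

(** The moral graph of the subgraph induced by [W], without [Z]. It may have loops, since
    [via W a a] holds when [a] has a child in [W]; equal nodes are therefore treated apart below. *)
Definition mor (W Z : {set T}) : rel T := fun a c =>
  [&& a \in W :\: Z, c \in W :\: Z & adj G a c || via W a c].

Lemma viaP (W : {set T}) a c : reflect (exists b b', [/\ b \in W, b' \in W, dir G a b, dir G c b'
  & connect (undin W) b b']) (via W a c).
Proof.
apply: (iffP existsP) => [[b /existsP[b' /and5P[]]]|[b [b' []]]]; first by exists b, b'.
by move=> *; exists b; apply/existsP; exists b'; apply/and5P.
Qed.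

Lemma semi_ind (W : {set T}) u v : semi (ind W) u v = [&& u \in W, v \in W & semi G u v].
Proof. by rewrite /semi /= !inE !negbK; case: (u \in W); case: (v \in W). Qed.

Definition anterior (W A : {set T}) (v : T) :=
  exists2 a, a \in A & connect (semi (ind W)) v a.

Hypothesis cgG : is_CG G.

Lemma connect_ind (W : {set T}) : subrel (connect (semi (ind W))) (connect (semi G)).
Proof.
by apply: connect_sub => u v; rewrite semi_ind => /and3P[_ _]; apply: connect1.
Qed.

Lemma undin_sym (W : {set T}) : symmetric (undin W).
Proof. by move=> u v; rewrite /undin cg_und_sym // andbCA. Qed.

Lemma connect_undin (W : {set T}) : subrel (connect (undin W)) (connect (und G)).
Proof. by apply: connect_sub => u v /and3P[_ _]; apply: connect1. Qed.

Lemma connect_und_semi : subrel (connect (und G)) (connect (semi G)).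
Proof. by apply: connect_sub => u v; apply: und_connect. Qed.

Section OpenMoral.
Variables (Z : {set T}) (x y : T).
Let A : {set T} := [set x; y] :|: Z.
Let W : {set T} := [set v | [exists a, (a \in A) && connect (semi G) v a]].

Let WA a : a \in A -> a \in W.
Proof. by move=> aA; rewrite inE; apply/existsP; exists a; rewrite aA connect0. Qed.

Let Wup u v : semi G u v -> v \in W -> u \in W.
Proof.
move=> uv; rewrite !inE => /existsP[a /andP[aA va]]; apply/existsP; exists a.
by rewrite aA (connect_trans (connect1 uv)).
Qed.

Let Wdir u v : dir G u v -> v \in W -> u \in W.
Proof. by move=> uv; apply: Wup; rewrite /semi uv. Qed.

Let Wund u v : und G u v -> v \in W -> u \in W.
Proof. by move=> uv; apply: Wup; rewrite /semi uv orbT. Qed.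

Let WZ v : v \in Z -> v \in W.
Proof. by move=> vZ; apply: WA; rewrite inE vZ orbT. Qed.

(** From an unhit section entered by an arrowhead, a route can go on only along semidirected edges
    until it meets [Z] or stops at [y]. *)
Let unhit_anterior s p v : s != Some true -> path (lstep G Z) (v, Some false) p ->
  last (v, Some false) p = (y, s) -> v \in W.
Proof.
move=> s1; elim: p v => [|[v' s'] p IH] v; first by move=> _ [-> _]; apply: WA; rewrite !inE eqxx orbT.
rewrite [path _ _ _]/(_ && _) => /andP[/lstepP st pp] e.
have v'W : s' = Some (v' \in Z) -> v' \in W.
  by case: (boolP (v' \in Z)) => [/WZ//|_ es]; rewrite es in pp e; apply: IH.
case: st => [[u _ /v'W]|[_ //]|[d _ /v'W]]; first exact: Wund.
exact: Wdir.
Qed.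

Lemma open_moral : lopen G Z x y -> connect (mor W Z) x y.
Proof.
case=> xZ [s s1 /connectP[p pp e]].
pose R := connect (mor W Z) x.
(* The node from which the section was entered is remembered, because a route leaving the section
   upwards goes to a node married to it. *)
pose entry v := exists u b, [/\ R u, u \in W :\: Z, b \in W, dir G u b & connect (undin W) b v].
pose inv v st := match st with
  | None => R v /\ v \in W :\: Z
  | Some false => [/\ R v, v \notin Z & entry v]
  | Some true => v \in W /\ entry v end.
suff main q v st : inv v st -> path (lstep G Z) (v, st) q ->
    last (v, st) q = (y, s) -> R y.
  apply: (main p x None) => //; split; first exact: connect0.
  by rewrite inE xZ WA // !inE eqxx.
elim: q v st => [|[v' s'] q IH] v st iv.
  by move=> _ [<- es]; move: s1 iv; rewrite -es; case: st {es} => [[]|] //= _ [].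
rewrite [path _ _ _]/(_ && _) => /andP[stp pq] eq.
have vW : v \in W.
  move: iv stp eq; case: st => [[]|]; [by case| |by case=> _; rewrite inE => /andP[]].
  move=> _ stp; apply: (unhit_anterior s1 (p := (v', s') :: q)).
  by apply/andP.
have unhit : s' = Some (v' \in Z) -> v' \notin Z -> v' \in W.
  by move=> es v'Z; apply: (unhit_anterior s1 (p := q)); rewrite -?(negbTE v'Z) -es.
have go u : R u -> u \in W :\: Z -> v' \in W :\: Z -> adj G u v' || via W u v' -> R v'.
  by move=> Ru uW vW' a; apply: connect_trans Ru (connect1 _); apply/and3P.
have down : R v -> v \notin Z -> dir G v v' -> s' = Some (v' \in Z) -> inv v' s'.
  move=> Rv vZ d es; have vWZ : v \in W :\: Z by rewrite inE vZ.
  have v'W : v' \in W by case: (boolP (v' \in Z)) => [/WZ|/(unhit es)].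
  have en : entry v' by exists v, v'.
  rewrite es /inv; case: (boolP (v' \in Z)) => v'Z; split=> //.
  by apply: (go v) => //; [rewrite inE v'Z|rewrite /adj d].
apply: IH pq eq; case/lstepP: stp => -[].
- move=> u vz es; have u' : und G v' v by rewrite cg_und_sym.
  have v'W : v' \in W by apply: Wund u' vW.
  have auv : adj G v v' by rewrite /adj u !orbT.
  have ext : entry v -> entry v'.
    case=> w [b [Rw wW bW db cb]]; exists w, b; split=> //.
    by apply: connect_trans cb (connect1 _); rewrite /undin vW v'W u.
  rewrite {}es; case: st iv vz => [[]|] /= iv vz.
  + by case: iv => _ /ext.
  + case: iv => Rv vZ /ext en; case: (boolP (v' \in Z)) => v'Z //; split=> //.
    by apply: (go v) => //; [rewrite inE vZ|rewrite inE v'Z|rewrite auv].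
  + case: iv => Rv vWZ; have v'WZ : v' \in W :\: Z by rewrite inE vz.
    by split=> //; apply: (go v) => //; rewrite auv.
- move=> d sf -> v'Z.
  have v'W : v' \in W by apply: Wdir d vW.
  have v'WZ : v' \in W :\: Z by rewrite inE v'Z.
  have adv : adj G v v' by rewrite /adj d orbT.
  split=> //; case: st iv sf => [[]|] //= iv _.
    case: iv => _ [w [b [Rw wW bW db cb]]]; apply: (go w) => //.
    by apply/orP; right; apply/viaP; exists b, v.
  by case: iv => Rv vWZ; apply: (go v) => //; rewrite adv.
- move=> d st' es; apply: down => //.
    by case: st iv st' {es} => [[]|] //= [].
  by case: st iv st' {es} => [[]|] //= [] //; rewrite inE => _ /andP[].
Qed.
End OpenMoral.

(** With all other nodes anterior to [x] or [y] in [Z], only [x] and [y] remain in the moral graph.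
    Marrying them would need a child anterior to one of them, which closes a semidirected cycle. *)
Lemma lwf_separable x y : x != y -> ~~ adj G x y ->
  exists Z : {set T}, [/\ x \notin Z, y \notin Z & ~ lopen G Z x y].
Proof.
move=> xy nxy.
pose Z := [set v | connect (semi G) v x || connect (semi G) v y] :\: [set x; y].
exists Z; split; rewrite ?inE ?eqxx ?orbT //.
move/open_moral; set W := [set v | _]; move/connectP=> [p pp e].
have WE v : v \in W -> connect (semi G) v x || connect (semi G) v y.
  rewrite !inE => /existsP[a /andP[aA va]]; move: aA; rewrite !inE => /orP[/orP[]/eqP <-|].
  - by rewrite va.
  - by rewrite va orbT.
  by case/andP=> _ /orP[h|h]; rewrite (connect_trans va h) ?orbT.
have WZ v : v \in W :\: Z -> (v == x) || (v == y).
  by rewrite inE => /andP[vZ /WE h]; move: vZ; rewrite /Z !inE h andbT negbK.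
suff /negP[] : ~~ mor W Z x y.
  apply/negP=> nm; have walk q : path (mor W Z) x q -> last x q = x.
    elim: q => //= v q IH /andP[xv]; have /and3P[_ /WZ/orP[/eqP->//|/eqP vy] _] := xv.
    by rewrite vy in xv.
  by have := walk p pp; rewrite -e => yx; rewrite yx eqxx in xy.
apply/negP=> /and3P[_ _ /orP[|/viaP[b [b' [/WE bW _ xb yb' bb']]]]]; first by apply/negP.
have b'b : connect (semi G) b' b.
  apply: connect_und_semi; apply: (@connect_undin W).
  by rewrite (sym_connect_sym (undin_sym W)).
case/orP: bW => h; first exact: cg_no_cycle xb h.
by apply: (cg_no_cycle cgG yb'); apply: connect_trans b'b h.
Qed.

End Moral.

(** * Graphs with the same complexes *)

Section Complexes.
Variables (T : finType) (F : graph T).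

(* The nodes [v i, ..., v j] form a complex up to chords: an undirected path
   between two arrowheads. *)
Definition cpx (v : nat -> T) (i j : nat) : Prop :=
  [/\ i.+1 < j, dir F (v i) (v i.+1), dir F (v j) (v j.-1) &
      forall l, i < l -> l.+1 < j -> und F (v l) (v l.+1)].

Hypothesis cgF : is_CG F.
Variable Z : {set T}.

(** Outside [Z] the machine gets stuck only when the walk leaves upwards a section entered by an
    arrowhead, and then the walk has just traced a complex. *)
Lemma walk_open_or_cpx v i n : i <= n ->
  (forall l, i <= l <= n -> v l \notin Z) ->
  (forall l, i <= l < n -> adj F (v l) (v l.+1)) ->
  (exists i' j', [/\ i <= i', j' <= n & cpx v i' j']) \/ lopen F Z (v i) (v n).
Proof.
move=> le_in vZ av.
have main k : i <= k <= n ->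
  [\/ exists i' j', [/\ i <= i', j' <= n & cpx v i' j'],
      connect (lstep F Z) (v i, None) (v k, None)
    | connect (lstep F Z) (v i, None) (v k, Some false) /\
      exists2 i', i <= i' < k & dir F (v i') (v i'.+1) /\
        forall l, i' < l < k -> und F (v l) (v l.+1)].
  elim: k => [|k IH] ik.
    by have -> : i = 0 by [lia]; apply: Or32; apply: connect0.
  have [->|nik] := eqVneq i k.+1; first by apply: Or32; apply: connect0.
  have ik' : i <= k <= n by lia.
  have nZ : v k.+1 \notin Z by apply: vZ.
  have down : dir F (v k) (v k.+1) -> forall s, s <> Some true ->
      connect (lstep F Z) (v i, None) (v k, s) ->
      connect (lstep F Z) (v i, None) (v k.+1, Some false) /\
      exists2 i', i <= i' < k.+1 & dir F (v i') (v i'.+1) /\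
        forall l, i' < l < k.+1 -> und F (v l) (v l.+1).
    move=> d s s1 c; split; last by exists k; [lia|split=> // l; lia].
    apply: connect_trans c (connect1 _); apply/lstepP; apply: Or33.
    by rewrite (negbTE nZ).
  have akk : adj F (v k) (v k.+1) by apply: av; lia.
  case: (IH ik') => [cp|c|[c [i' i'k [d u]]]]; first by apply: Or31.
    case/or3P: akk => e.
    - by apply: Or33; apply: (down e None).
    - by apply: Or32; apply: connect_trans c (connect1 _); apply/lstepP; apply: Or32.
    - by apply: Or32; apply: connect_trans c (connect1 _); apply/lstepP; apply: Or31.
  case/or3P: akk => e.
  - by apply: Or33; apply: (down e (Some false)).
  - apply: Or31; exists i', k.+1; split; [lia|lia|split=> //].
      have [ki|ki] := eqVneq k i'; last lia.
      by rewrite ki (dir_asym cgF d) in e.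
    by move=> l il lk; apply: u; lia.
  - apply: Or33; split.
      apply: connect_trans c (connect1 _); apply/lstepP; apply: Or31.
      by split=> //; rewrite (negbTE nZ).
    exists i'; first lia; split=> // l il.
    by have [->//|lk] := eqVneq l k; apply: u; lia.
have iZ : v i \notin Z by apply: vZ; rewrite leqnn.
case: (main n); first by rewrite le_in leqnn.
- by left.
- by move=> c; right; split=> //; exists None.
- by case=> c _; right; split=> //; exists (Some false).
Qed.

Lemma cpx_open v i j : cpx v i j -> v i \notin Z -> v j \notin Z ->
  (exists2 l, i < l < j & v l \in Z) -> lopen F Z (v i) (v j).
Proof.
case=> ij di dj u iZ jZ [h ih hZ]; split=> //.
have main k : i < k < j -> exists2 b : bool, (h <= k -> b) &
    connect (lstep F Z) (v i, None) (v k, Some b).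
  elim: k => [|k IH] ik; first by lia.
  have [ik'|ik'] := eqVneq i k.
    exists (v k.+1 \in Z) => [hk|]; first by have -> : k.+1 = h by lia.
    by rewrite -ik'; apply: connect1; apply/lstepP; apply: Or33.
  have [|b hb c] := IH; first lia.
  exists (b || (v k.+1 \in Z)) => [hk|].
    have [<-|hk'] := eqVneq h k.+1; first by rewrite hZ orbT.
    by rewrite hb //; lia.
  apply: connect_trans c (connect1 _); apply/lstepP; apply: Or31; split=> //.
  by apply: u; lia.
have [|b hb c] := main j.-1; first lia.
exists None => //; apply: connect_trans c (connect1 _); apply/lstepP; apply: Or32.
by split=> //; rewrite hb //; lia.
Qed.

End Complexes.

Section SameComplexes.
Variables (T : finType) (G H : graph T).
Hypotheses (cgG : is_CG G) (cgH : is_CG H).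
Hypothesis adjE : adj G =2 adj H.
Hypothesis HG : forall (Z : {set T}) x y, x != y -> x \notin Z -> y \notin Z ->
  lopen H Z x y -> lopen G Z x y.

Definition chordless (v : nat -> T) n :=
  (forall l, l < n -> adj G (v l) (v l.+1)) /\
  (forall i j, i.+1 < j <= n -> (v i != v j) && ~~ adj G (v i) (v j)).

Lemma cpx_inner_unique (F : graph T) v n i j : is_CG F -> cpx F v 0 n -> j <= n ->
  cpx F v i j -> i = 0 /\ j = n.
Proof.
move=> cgF [n1 d0 dn u] jn [ij di dj ui]; split.
  have [//|i0] := posnP i.
  by have := u i i0 ltac:(lia); rewrite (dir_und cgF di).
have [//|jn'] := eqVneq j n.
have := u j.-1 ltac:(lia) ltac:(lia); rewrite prednK; last lia.
by rewrite (dir_und' cgF dj).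
Qed.

Lemma cpx_shift (F : graph T) v i j : cpx F v i j <-> (i <= j /\ cpx F (fun l => v (i + l)) 0 (j - i)).
Proof.
split=> [[ij di dj u]|[le [ij di dj u]]].
  split; first lia; split; [lia|by rewrite addn0 addn1| |].
    by have -> : i + (j - i) = j by [lia]; have -> : i + (j - i).-1 = j.-1 by lia.
  by move=> l l0 lj; rewrite addnS; apply: u; lia.
rewrite addn0 addn1 in di; split=> //; first lia.
  move: dj; have -> : i + (j - i) = j by lia.
  by have -> : i + (j - i).-1 = j.-1 by lia.
move=> l il lj; have := u (l - i) ltac:(lia) ltac:(lia).
have -> : i + (l - i) = l by lia.
by have -> : i + (l - i).+1 = l.+1 by lia.
Qed.

Lemma chordless_separable v n i j : chordless v n -> i.+1 < j <= n ->
  exists Z : {set T}, [/\ v i \notin Z, v j \notin Z, ~ lopen G Z (v i) (v j)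
    & ~ lopen H Z (v i) (v j)].
Proof.
case=> _ ch ij; have /andP[ne na] := ch i j ij.
have [Z [iZ jZ nop]] := lwf_separable cgG ne na.
by exists Z; split=> // /HG; auto.
Qed.

(** A separator of the ends misses the complex, so the walk, being closed in [G], contains a complex
    of [G]. The same argument on that part, with the graphs exchanged, finds a complex of [H] inside
    it, which can only be the whole walk. *)
Lemma cpx_HG v n : chordless v n -> cpx H v 0 n -> cpx G v 0 n.
Proof.
move=> ch cH; have [n1 _ _ _] := cH.
have [Z [iZ jZ nG nH]] := chordless_separable ch (i := 0) (j := n) ltac:(lia).
have inner l : 0 <= l <= n -> v l \notin Z.
  move=> ln; apply/negP=> lZ; apply: nH; apply: (cpx_open cH) => //.
  exists l => //; apply/andP; split.
    by have [l0|//] := posnP l; move: iZ; rewrite -l0 lZ.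
  by have [l0|?] := eqVneq l n; [move: jZ; rewrite -l0 lZ|lia].
case: (walk_open_or_cpx cgG (leq0n n) inner) => [l ln|[i [j [_ jn cij]]]|//].
  by case: ch => + _; apply.
suff [<- <-] : i = 0 /\ j = n by [].
have [ij _ _ _] := cij.
have ijn : i.+1 < j <= n by rewrite ij.
have [Z' [iZ' jZ' nG' nH']] := chordless_separable ch ijn.
have inner' l : i <= l <= j -> v l \notin Z'.
  move=> ln; apply/negP=> lZ; apply: nG'; apply: (cpx_open cij) => //.
  exists l => //; apply/andP; split.
    by have [l0|?] := eqVneq l i; [move: iZ'; rewrite -l0 lZ|lia].
  by have [l0|?] := eqVneq l j; [move: jZ'; rewrite -l0 lZ|lia].
case: (walk_open_or_cpx cgH _ inner') => [|l ln|[i' [j' [ii' jj' c']]]|//]; first lia.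
  by rewrite -adjE; case: ch => + _; apply; lia.
have [] := cpx_inner_unique cgH cH _ c'; lia.
Qed.

Lemma chordless_shift v n i j : chordless v n -> i <= j <= n ->
  chordless (fun l => v (i + l)) (j - i).
Proof.
case=> av ch ij; split=> [l l1|a b ab]; first by rewrite addnS; apply: av; lia.
by apply: ch; lia.
Qed.

(** Here the complex found in [H] is carried back to [G] by [cpx_HG], and uniqueness in [G] makes it
    the whole walk. *)
Lemma cpx_GH v n : chordless v n -> cpx G v 0 n -> cpx H v 0 n.
Proof.
move=> ch cG; have [n1 _ _ _] := cG.
have [Z [iZ jZ nG nH]] := chordless_separable ch (i := 0) (j := n) ltac:(lia).
have inner l : 0 <= l <= n -> v l \notin Z.
  move=> ln; apply/negP=> lZ; apply: nG; apply: (cpx_open cG) => //.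
  exists l => //; apply/andP; split.
    by have [l0|//] := posnP l; move: iZ; rewrite -l0 lZ.
  by have [l0|?] := eqVneq l n; [move: jZ; rewrite -l0 lZ|lia].
case: (walk_open_or_cpx cgH (leq0n n) inner) => [l ln|[i [j [_ jn cij]]]|//].
  by rewrite -adjE; case: ch => + _; apply.
have /cpx_shift[ij c'] := cij.
have cG' : cpx G v i j.
  apply/cpx_shift; split=> //; apply: cpx_HG c'.
  by apply: chordless_shift ch _; rewrite ij.
by have [<- <-] := cpx_inner_unique cgG cG jn cG'.
Qed.

Section Shorten.
Variable F : graph T.
Hypotheses (cgF : is_CG F) (FE : adj G =2 adj F).
Variables (W : {set T}) (a c : T).

Let inW v n := [/\ cpx F v 0 n, v 0 = a, v n = c & forall l, 0 < l < n -> v l \in W].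

(** One condition per position covers arrows and undirected edges alike, so that splicing requires a
    check at a single position. *)
Let edge v n l := if l == 0 then dir F (v 0) (v 1)
  else if l.+1 == n then dir F (v l.+1) (v l) else und F (v l) (v l.+1).

Let cpx_edges v n : cpx F v 0 n <-> (1 < n /\ forall l, l < n -> edge v n l).
Proof.
rewrite /edge; split=> [[n1 d0 dn u]|[n1 e]].
  split=> // l ln; case: posnP => [//|l0]; case: eqP => [ln'|ln']; first by rewrite ln' -[l]/(l.+1.-1) ln'.
  by apply: u; lia.
split=> //; first by have := e 0 ltac:(lia).
  have := e n.-1 ltac:(lia); rewrite prednK; last lia.
  by rewrite eqxx; case: eqP => // ?; lia.
move=> l l0 ln; have := e l ltac:(lia).
by case: eqP => [?|_]; [lia|case: eqP => [?|//]; lia].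
Qed.

Lemma via_inW : via F W a c <-> exists v n, inW v n.
Proof.
split=> [/viaP[b [b' [bW b'W ab cb' /connectP[p pp e]]]]|[v [n [[n1 d0 dn u] va vc vW]]]].
  pose s := a :: b :: rcons p c; pose v l := nth a s l.
  have sz : size s = (size p).+3 by rewrite /= size_rcons.
  have vb l : l <= size p -> v l.+1 = nth b (b :: p) l.
    by move=> lp; rewrite /v /s -[nth _ _ _]/(nth a (rcons (b :: p) c) l) nth_rcons /= ltnS lp; apply: set_nth_default.
  have pW l : l <= size p -> nth b (b :: p) l \in W.
    elim: l => [//|l IHl] lp.
    by have := pathP b pp l lp => /and3P[].
  have vc : v (size p).+2 = c by rewrite /v /s /= nth_rcons ltnn eqxx.
  exists v, (size p).+2; split.
  - split=> //.
      by rewrite vc -[_.-1]/((size p).+1) vb // -(last_nth b) -e.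
    move=> [//|l] _ lp; rewrite !vb; [|lia..].
    by have := pathP b pp l lp => /and3P[].
  - by [].
  - by [].
  - by move=> [//|l] /= lp; rewrite vb; [apply: pW|]; lia.
apply/viaP; exists (v 1), (v n.-1); split.
- by apply: vW; lia.
- by apply: vW; lia.
- by rewrite -va.
- by rewrite -vc.
have : forall l, 0 < l < n -> connect (undin F W) (v 1) (v l).
  elim=> [//|l IH] ln; have [->|l0] := posnP l; first exact: connect0.
  apply: connect_trans (IH _) (connect1 _); first lia.
  by apply/and3P; split; [apply: vW; lia|apply: vW; lia|apply: u; lia].
by apply; lia.
Qed.

Let up v n i j : cpx F v 0 n -> 0 < i -> i <= j -> j < n ->
  connect (und F) (v i) (v j).
Proof.
case=> n1 d0 dn u i0 ij jn; elim: j ij jn => [|j IH] ij jn; first lia.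
have [->|ne] := eqVneq i j.+1; first exact: connect0.
by apply: connect_trans (IH _ _) (connect1 (u _ _ _)); lia.
Qed.

(** A shortest connection is taken. A repeated node or a chord, whose orientation is forced by
    acyclicity, would give a shorter one. *)
Lemma via_chordless : a != c -> ~~ adj F a c -> via F W a c ->
  exists v n, inW v n /\ chordless v n.
Proof.
move=> nac naac /via_inW[v0 [n0 vn0]].
have [n [v vn min]] : exists n, exists2 v, inW v n & forall v' n', inW v' n' -> n <= n'.
  elim/ltn_ind: n0 v0 vn0 => n IH v vn.
  case: (classic (exists v' n', inW v' n' /\ n' < n)) => [[v' [n' [w lt]]]|no].
    exact: IH lt _ w.
  exists n, v => // v' n' w; rewrite leqNgt; apply/negP=> lt.
  by apply: no; exists v', n'.
exists v, n; split=> //; have [cv va vc vW] := vn.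
have /cpx_edges[n1 ev] := cv.
have sub (F' : rel T) x y : connect (und F) x y -> connect (semi F) x y.
  exact: connect_und_semi.
split=> [l ln|i j ijn].
  rewrite FE /adj; have := ev l ln; rewrite /edge.
  case: eqP => [->->//|_]; case: eqP => [_ ->|_ ->]; by rewrite !orbT.
have [n1' d0 dn u] := cv.
have [e0|] := boolP ((i == 0) && (j == n)).
  by case/andP: e0 => /eqP-> /eqP->; rewrite va vc nac FE.
move=> e0; have lt : j - i < n by lia.
(* [w] omits the [d] nodes after position [i]; all its edges but the one at [i] are edges of [v]. A
   repetition uses [d = j - i], a chord [d = j - i.+1]. *)
have cut d w : 0 < d -> w = (fun l => if l <= i then v l else v (l + d)) ->
    i + d < n -> 1 < n - d ->
    edge w (n - d) i -> False.
  move=> d0' wE id nd ei; suff : inW w (n - d) by move/min; lia.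
  split.
  - apply/cpx_edges; split=> // l ln.
    have [->//|li] := eqVneq l i.
    have [lti|gti] := ltnP l i.
      have lei : l <= i by apply: ltnW.
      have := ev l ltac:(lia); rewrite /edge wE lti lei.
      have -> : (l.+1 == n) = false by lia.
      have -> : (l.+1 == n - d) = false by lia.
      by case: eqP lti => [-> lti|_ _ //]; rewrite lti.
    have := ev (l + d) ltac:(lia); rewrite /edge wE.
    have -> : (l + d == 0) = false by lia.
    have -> : (l == 0) = false by lia.
    have -> : (l <= i) = false by lia.
    have -> : (l < i) = false by lia.
    have -> : ((l + d).+1 == n) = (l.+1 == n - d) by lia.
    by rewrite addSn.
  - by rewrite wE leq0n.
  - rewrite wE; have -> : (n - d <= i) = false by lia.
    by have -> : n - d + d = n by lia.
  - move=> l ln; rewrite wE; case: leqP => li; apply: vW; lia.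
apply/andP; split; apply/negP.
  move/eqP=> vij.
  have i0 : 0 < i.
    rewrite lt0n; apply/eqP=> i0; rewrite i0 in vij e0 ijn *.
    have jn : j < n by lia.
    apply: (cg_no_cycle cgF d0); rewrite vij; apply: (sub (und F)); apply: up cv _ _ _; lia.
  have jn : j < n.
    rewrite ltn_neqAle; apply/andP; split; last lia; apply/eqP=> jn.
    apply: (cg_no_cycle cgF dn); rewrite -jn -vij; apply: (sub (und F)).
    rewrite (sym_connect_sym (cg_und_sym cgF)); apply: up cv _ _ _; lia.
  apply: (cut (j - i) _ _ (erefl _)); try lia.
  have := ev j jn; rewrite /edge leqnn ltnn.
  have -> : (j == 0) = false by lia.
  have -> : (i == 0) = false by lia.
  have -> : (j.+1 == n) = (i.+1 == n - (j - i)) by lia.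
  have -> : i.+1 + (j - i) = j.+1 by lia.
  by rewrite vij.
move=> aij; rewrite FE in aij.
apply: (cut (j - i.+1) _ _ (erefl _)); try lia.
rewrite /edge leqnn ltnn; have -> : i.+1 + (j - i.+1) = j by lia.
have [i0|i0] := posnP i.
  rewrite i0 leqnn /=; have -> : 1 + (j - 1) = j by lia.
  rewrite i0 in aij; apply: (dir_closes cgF d0 _ aij); apply: (sub (und F)).
  apply: up cv _ _ _; lia.
have [jn|jn] := eqVneq j n.
  have -> : (i.+1 == n - (j - i.+1)) = true by lia.
  rewrite jn in aij *.
  apply: (dir_closes cgF dn); last by rewrite cg_adj_sym.
  apply: (sub (und F)); rewrite (sym_connect_sym (cg_und_sym cgF)); apply: up cv _ _ _; lia.
have -> : (i.+1 == n - (j - i.+1)) = false by lia.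
apply: (und_closes cgF _ (connect0 _ _)) => //; apply: up cv _ _ _; lia.
Qed.

End Shorten.

Lemma via_same W a c : a != c -> ~~ adj G a c -> via G W a c = via H W a c.
Proof.
move=> ac nac; apply/idP/idP=> vi.
  have [v [n [[cp va vc vW] ch]]] := via_chordless cgG (fun _ _ => erefl) ac nac vi.
  by apply/via_inW; exists v, n; split=> //; apply: cpx_GH.
have nac' : ~~ adj H a c by rewrite -adjE.
have [v [n [[cp va vc vW] ch]]] := via_chordless cgH adjE ac nac' vi.
by apply/via_inW; exists v, n; split=> //; apply: cpx_HG.
Qed.

End SameComplexes.

(** * Peeling a block of [H] off a moral graph of [G] *)

Section MoralPeel.
Variables (T : finType) (G H : graph T).
Hypotheses (cgG : is_CG G) (cgH : is_CG H).
Hypothesis adjE : adj G =2 adj H.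
Hypothesis viaE : forall W a c, a != c -> ~~ adj G a c -> via G W a c = via H W a c.
Variables (W K A : {set T}).
Hypothesis KW : K \subset W.
Hypothesis KA : [disjoint K & A].
Hypothesis KH : terminal_block (ind H W) K.
Hypothesis antW : forall w, w \in W -> anterior G W A w.

Let adjC : symmetric (adj G) := cg_adj_sym cgG.

Let inW k : k \in K -> k \in W. Proof. exact: (subsetP KW). Qed.

Let KH1 k k' : k \in K -> k' \in K -> adj G k k' -> und H k k'.
Proof.
move=> kK k'K kk'; have [+ _] := KH => /(_ k k' kK k'K).
rewrite adj_gdel !inE !negbK (inW kK) (inW k'K) -adjE kk' => /(_ isT).
by case/and3P.
Qed.

Let KH2 u k : u \in W :\: K -> k \in K -> adj G u k -> dir H u k.
Proof.
move=> /setDP[uW uK] kK uk; have [_ +] := KH => /(_ u k uK kK).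
rewrite adj_gdel !inE !negbK (inW kK) uW -adjE uk => /(_ isT).
by case/and3P.
Qed.

(** Both [a] and [d] point into [K] in [H], where [B] connects their children by undirected edges.
    If distinct and nonadjacent they would also have children in [B] in [G]; but in [G] every node
    of [B] leads to [d], which gives a cycle. *)
Let closing k u d a : k \in K -> connect (semi (ind G K)) k u -> u \in K ->
  semi G u d -> d \in W :\: K -> a \in W :\: K -> semi G a k -> a = d \/ adj G a d.
Proof.
move=> kK ku uK ud dW aW ak; case: (eqVneq a d) => [->|nad]; first by left.
right; apply/negPn/negP=> nadj.
pose B := [set b in K | connect (semi (ind G K)) b u].
have BK b : b \in B -> b \in K by rewrite inE => /andP[].
suff vH : via H B a d.
  rewrite -viaE // in vH; case/viaP: vH => b [b' [_ b'B _ db' _]].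
  apply: (cg_no_cycle cgG db'); apply: connect_trans (connect1 ud).
  by apply: (connect_ind (W := K)); move: b'B; rewrite inE => /andP[].
apply/viaP; exists k, u; split.
- by rewrite inE kK.
- by rewrite inE uK connect0.
- by apply: KH2 => //; apply: semi_adj.
- by apply: KH2 => //; rewrite adjC; apply: semi_adj.
case/connectP: ku => p pp e.
elim: p k kK pp e {ak} => [|k' p IH] k kK; first by move=> _ /= ->; apply: connect0.
move=> pp e; have kB : k \in B by rewrite inE kK; apply/connectP; exists (k' :: p).
move: pp e => /andP[]; rewrite semi_ind => /and3P[_ k'K kk'] pp e.
apply: connect_trans (IH k' k'K pp e); apply: connect1; apply/and3P; split=> //.
  by rewrite inE k'K; apply/connectP; exists p.
by apply: KH1 => //; apply: semi_adj.
Qed.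

Let antWK := anterior G (W :\: K) A.

(** By induction along a path to [A]: a node entering [K] can jump by [closing] to the node [d]
    where the path leaves [K]. *)
Let exits v : v \in W -> if v \in K then
    exists u d, [/\ connect (semi (ind G K)) v u, u \in K, semi G u d, d \in W :\: K & antWK d]
  else antWK v.
Proof.
case/antW=> a aA /connectP[p pp e].
elim: p v pp e => [|v' p IH] v.
  move=> _ /= e; have aK : a \notin K by apply/negP=> /(disjointFr KA); rewrite aA.
  by rewrite -e (negbTE aK); exists a => //; apply: connect0.
case/andP=> st pp e; have := IH v' pp e.
move: st; rewrite semi_ind => /and3P[vW v'W vv'].
have [v'K [u [d [v'u uK ud dW antd]]]|v'K antv'] := boolP (v' \in K);
  have [vK|vK] := boolP (v \in K).
- exists u, d; split=> //; apply: connect_trans (connect1 _) v'u.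
  by rewrite semi_ind vK v'K.
- have vWK : v \in W :\: K by rewrite inE vK.
  have [ed|avd] := closing v'K v'u uK ud dW vWK vv'; first by rewrite ed.
  have sd : semi G v d.
    apply: (semi_closes cgG _ avd); apply: connect_trans (connect1 vv') _.
    by apply: connect_trans (connect_ind v'u) (connect1 ud).
  case: antd => a' a'A c; exists a' => //; apply: connect_trans (connect1 _) c.
  by rewrite semi_ind vWK dW.
- by exists v, v'; split=> //; rewrite inE v'K.
- have vWK : v \in W :\: K by rewrite inE vK.
  case: antv' => a' a'A c; exists a' => //; apply: connect_trans (connect1 _) c.
  by rewrite semi_ind vWK inE v'K v'W.
Qed.

Lemma anterior_peel w : w \in W :\: K -> anterior G (W :\: K) A w.
Proof. by case/setDP=> wW wK; have := exits wW; rewrite (negbTE wK). Qed.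

(** A semidirected path leaves [K] at some [d], and by [closing] both parents point to [d] in [G],
    so [d] is a common child outside [K]. *)
Let via_bypass a c : a \in W :\: K -> c \in W :\: K -> via H K a c ->
  [\/ a = c, adj G a c | via G (W :\: K) a c].
Proof.
move=> aW cW vH; case: (eqVneq a c) => [->|nac]; first exact: Or31.
have [ac|nadj] := boolP (adj G a c); first exact: Or32.
apply: Or33; rewrite -viaE // in vH; case/viaP: vH => b [b' [bK b'K ab cb' bb']].
have := exits (inW bK); rewrite bK => -[u [d [bu uK ud dW _]]].
have b'b : connect (semi (ind G K)) b' b.
  rewrite (sym_connect_sym (undin_sym cgG K)) in bb'.
  apply: connect_sub bb' => s t /and3P[sK tK st]; apply: connect1.
  by rewrite semi_ind sK tK /semi st orbT.
have b'u := connect_trans b'b bu.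
have to k e : k \in K -> connect (semi (ind G K)) k u -> e \in W :\: K ->
    dir G e k -> dir G e d.
  move=> kK ku eW ek.
  have kd : connect (semi G) k d := connect_trans (connect_ind ku) (connect1 ud).
  have sek : semi G e k by rewrite /semi ek.
  have [ed|aed] := closing kK ku uK ud dW eW sek; last exact: (dir_closes cgG ek kd aed).
  by rewrite ed in ek; case: (cg_no_cycle cgG ek kd).
apply/viaP; exists d, d; split=> //; [exact: to ab|exact: to cb'].
Qed.

Lemma moral_peel (Z : {set T}) x y : x \in A -> y \in A ->
  connect (mor G W Z) x y -> connect (mor G (W :\: K) Z) x y.
Proof.
move=> xA yA /connectP[p pp e].
have notK a : a \in A -> a \notin K.
  by move=> aA; apply/negP=> aK; have := disjointFr KA aK; rewrite aA.
pose R := connect (mor G (W :\: K) Z) x.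
(* Inside [K] only the entry point is kept: on leaving, it and the exit are married in [H] through
   [K], and [via_bypass] replaces this marriage. *)
pose inv v := if v \in K then
    exists a k, [/\ a \in W :\: K, a \notin Z, R a, k \in K & dir H a k /\ connect (undin H K) k v]
  else R v.
suff main q v : inv v -> path (mor G W Z) v q -> inv (last v q).
  suff: inv y by rewrite /inv (negbTE (notK y yA)).
  by rewrite e; apply: main pp; rewrite /inv (negbTE (notK x xA)); apply: connect0.
elim: q v => //= v' q IH v iv /andP[vv' pq]; apply: IH pq.
have [->//|nvv'] := eqVneq v' v; rewrite eq_sym in nvv'.
have /and3P[/setDP[vW vZ] /setDP[v'W v'Z] link] := vv'.
have linkK u : u \in W :\: K -> u \notin Z -> R u -> v' \notin K ->
    [\/ u = v', adj G u v' | via G (W :\: K) u v'] -> inv v'.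
  move=> uWK uZ Ru v'K l; rewrite /inv (negbTE v'K).
  case: l => [<-//|l|l]; apply: connect_trans Ru (connect1 _).
    by move: uWK => /setDP[uW uK]; rewrite /mor !inE uZ uK uW v'Z v'K v'W l.
  by move: uWK => /setDP[uW uK]; rewrite /mor !inE uZ uK uW v'Z v'K v'W l orbT.
(* Consequently a moral edge at a node of [K] is an adjacency and not a marriage. *)
have noarrow k b : k \in K -> b \in W -> dir H k b -> False.
  move=> kK bW d; have akb : adj G k b by rewrite adjE /adj d.
  have [bK|bK] := boolP (b \in K).
    by have := KH1 kK bK akb; rewrite (dir_und cgH d).
  have := KH2 (u := b) _ kK; rewrite inE bK bW adjC => /(_ isT akb).
  by rewrite (dir_asym cgH d).
have link' : adj G v v' || via H W v v'.
  have [//|nadj] := boolP (adj G v v').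
  by move: link; rewrite (negbTE nadj) /= viaE.
move: iv; rewrite {1}/inv; have [vK|vK] := boolP (v \in K).
  case=> a [k [aWK aZ Ra kK [dak ckv]]].
  have avv' : adj G v v'.
    case/orP: link' => // /viaP[b [_ [bW _ d _ _]]].
    by case: (noarrow v b vK bW d).
  have [v'K|v'K] := boolP (v' \in K).
    rewrite /inv v'K; exists a, k; split=> //; split=> //.
    apply: connect_trans ckv (connect1 _); apply/and3P; split=> //; exact: KH1.
  apply: (linkK a aWK aZ Ra v'K); have v'WK : v' \in W :\: K by rewrite inE v'K.
  apply: via_bypass => //; apply/viaP; exists k, v; split=> //.
  by apply: KH2 => //; rewrite adjC.
move=> Rv; have vWK : v \in W :\: K by rewrite inE vK.
have [v'K|v'K] := boolP (v' \in K).
  have avv' : adj G v v'.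
    case/orP: link' => // /viaP[_ [b [_ bW _ d _]]].
    by case: (noarrow v' b v'K bW d).
  rewrite /inv v'K; exists v, v'; split=> //; split; [exact: KH2|exact: connect0].
have v'WK : v' \in W :\: K by rewrite inE v'K.
apply: (linkK v vWK vZ Rv v'K); have [avv'|nadj] : adj G v v' \/ ~~ adj G v v' by case: (adj G v v'); [left|right].
  exact: Or32.
have /viaP[b [b' [bW b'W db db' bb']]] : via H W v v'.
  by move: link'; rewrite (negbTE nadj).
have side (B : {set T}) : b \in B ->
    (forall s t, undin H W s t -> s \in B -> t \in B) ->
    b' \in B /\ connect (undin H B) b b'.
  move=> bB cl; case/connectP: bb' => r rr ->.
  elim: r b bB rr {bW db} => [|t r IHr] s sB /=; first by split=> //; apply: connect0.
  case/andP=> st rr; have tB := cl s t st sB.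
  have [lB c] := IHr t tB rr; split=> //; apply: connect_trans c; apply: connect1.
  by case/and3P: st => _ _ u; rewrite /undin sB tB u.
have crossK s t : s \in K -> t \in W -> und H s t -> t \in K.
  move=> sK tW u; apply/negPn/negP=> tK.
  have ats : adj G t s by rewrite adjC adjE /adj u !orbT.
  have := KH2 (u := t) _ sK ats; rewrite inE tK tW => /(_ isT) d.
  by rewrite (dir_und' cgH d) in u.
have [bK|bK] := boolP (b \in K).
  have [|b'K c] := side K bK; first by move=> s t /and3P[_ tW u] sK; apply: crossK u.
  by apply: via_bypass => //; apply/viaP; exists b, b'.
apply: Or33; rewrite viaE //; have bWK : b \in W :\: K by rewrite inE bK.
have [|b'K c] := side _ bWK; last by apply/viaP; exists b, b'.
move=> s t /and3P[sW tW u] /setDP[_ sK]; rewrite inE tW andbT.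
by apply: contra sK => tK; apply: crossK tK sW _; rewrite cg_und_sym.
Qed.

End MoralPeel.

(** * From moral connection back to open LWF routes *)

Section MoralOpen.
Variables (T : finType) (H : graph T).
Hypothesis cgH : is_CG H.
Variables (W Z : {set T}) (x y : T).
Hypothesis xZ : x \notin Z.
Hypothesis antW : forall w, w \in W -> anterior H W ([set x; y] :|: Z) w.

Let reach := connect (lstep H Z) (x, None).
Let undC : symmetric (und H) := cg_und_sym cgH.

Let step1 u v s s' : lstep H Z (u, s) (v, s') -> forall t,
  connect (lstep H Z) t (u, s) -> connect (lstep H Z) t (v, s').
Proof. by move=> st t c; apply: connect_trans c (connect1 st). Qed.

Let tail_und u v t : und H u v -> v \notin Z ->
  connect (lstep H Z) t (u, None) -> connect (lstep H Z) t (v, None).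
Proof. by move=> uv vZ; apply: step1; apply/lstepP; apply: Or31. Qed.

Let head_und u v b t : und H u v ->
  connect (lstep H Z) t (u, Some b) -> connect (lstep H Z) t (v, Some (b || (v \in Z))).
Proof. by move=> uv; apply: step1; apply/lstepP; apply: Or31. Qed.

Let ascend u v s t : dir H v u -> v \notin Z -> s <> Some false ->
  connect (lstep H Z) t (u, s) -> connect (lstep H Z) t (v, None).
Proof. by move=> uv vZ sf; apply: step1; apply/lstepP; apply: Or32. Qed.

Let descend u v s t : dir H u v -> s <> Some true ->
  connect (lstep H Z) t (u, s) -> connect (lstep H Z) t (v, Some (v \in Z)).
Proof. by move=> uv sf; apply: step1; apply/lstepP; apply: Or33. Qed.

(* An unhit section at [v] can be left upwards after a detour down to [Z] and
   back, unless the way down first meets an end of the route. *)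
Let turn v : v \in W -> v \notin Z ->
  [\/ forall s, s <> Some true -> exists2 s', s' != Some true &
         connect (lstep H Z) (v, s) (y, s'),
      reach (v, None)
    | connect (lstep H Z) (v, Some false) (v, None) \/
      connect (lstep H Z) (v, Some false) (v, Some true)].
Proof.
case/antW=> a aA /connectP[p pp e].
elim: p v pp e => [|u p IH] v.
  move=> _ /= e; rewrite e !inE in aA * => vZ; move: aA.
  rewrite (negbTE vZ) orbF => /orP[]/eqP vE.
    by apply: Or32; rewrite vE; apply: connect0.
  by apply: Or31 => s /eqP s1; exists s => //; rewrite vE; apply: connect0.
case/andP; rewrite semi_ind => /and3P[_ _ /orP vu] pp e vZ.
have [uZ|uZ] := boolP (u \in Z).
  case: vu => [d|d]; apply: Or33; [left|right].
    by apply: (ascend d) (descend d _ (connect0 _ _)); rewrite ?uZ.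
  have := head_und d (connect0 _ (v, Some false)); rewrite uZ orbT => c.
  have d' : und H u v by rewrite undC.
  exact: head_und d' c.
case: (IH u pp e uZ) => [win|r|back].
- apply: Or31 => s s1.
  have [s' [s'1 c]] : exists s', s' <> Some true /\ connect (lstep H Z) (v, s) (u, s').
    case: vu => d.
      by exists (Some false); split=> //; have := descend d s1 (connect0 _ _); rewrite (negbTE uZ).
    case: s s1 => [[]|] // _.
      exists (Some false); split=> //.
      by have := head_und d (connect0 _ (v, Some false)); rewrite (negbTE uZ).
    by exists None; split=> //; apply: tail_und d uZ (connect0 _ _).
  have [s'' s''1 c'] := win s' s'1.
  by exists s'' => //; apply: connect_trans c c'.
- apply: Or32; case: vu => d; first exact: ascend d vZ _ r.
  by apply: tail_und vZ r; rewrite undC.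
- apply: Or33; case: vu => d.
    left; have c := descend d (s := Some false) _ (connect0 _ (v, Some false)).
    rewrite (negbTE uZ) in c.
    by case: back => b; apply: (ascend d vZ) (connect_trans (c _) b).
  have c := head_und d (connect0 _ (v, Some false)); rewrite (negbTE uZ) in c.
  case: back => b; [left|right].
    by apply: tail_und vZ (connect_trans c b); rewrite undC.
  have d' : und H u v by rewrite undC.
  exact: head_und d' (connect_trans c b).
Qed.

Let wins := exists2 s, s != Some true & reach (y, s).

Let at_head v : v \in W -> v \notin Z -> reach (v, Some false) ->
  wins \/ (reach (v, None) \/ reach (v, Some true)).
Proof.
move=> vW vZ r; case: (turn vW vZ) => [win|r'|[b|b]]; last 2 first.
- by right; left; apply: connect_trans r b.
- by right; right; apply: connect_trans r b.
- have [//|s s1 c] := win (Some false).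
  by left; exists s => //; apply: connect_trans r c.
by right; left.
Qed.

(** From these states a route can leave [v] in any direction: [None] allows all steps, [Some false]
    the downward ones, and [Some true] the upward ones. *)
Let free v := reach (v, None) \/ (reach (v, Some false) /\ reach (v, Some true)).

Let free_head v : v \in W -> v \notin Z -> reach (v, Some false) -> wins \/ free v.
Proof.
by move=> vW vZ r; case: (at_head vW vZ r) => [|[]]; [left|right; left|right; right].
Qed.

Lemma moral_open : connect (mor H W Z) x y -> lopen H Z x y.
Proof.
case/connectP=> p pp e; split=> //.
suff: wins \/ free y.
  case=> [[s s1 r]|[r|[r _]]]; [by exists s|by exists None|by exists (Some false)].
have: wins \/ free x by right; left; apply: connect0.
rewrite [in free y]e; elim: p x pp {e} => //= v p IH u /andP[uv pp] h.
apply: IH pp _; case: h => [|fu]; first by left.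
have /and3P[/setDP[uW uZ] /setDP[vW vZ] link] := uv.
have down w : dir H u w -> reach (w, Some (w \in Z)).
  by move=> d; case: fu => [r|[r _]]; apply: descend d _ r.
case/orP: link => [/or3P[] d|/viaP[b [b' [bW b'W ub vb' bb']]]].
- by apply: free_head => //; have := down v d; rewrite (negbTE vZ).
- by right; left; case: fu => [r|[_ r]]; apply: ascend d vZ _ r.
- right; case: fu => [r|[r1 r2]]; first by left; apply: tail_und d vZ r.
  right; split; last by have := head_und d r2.
  by have := head_und d r1; rewrite (negbTE vZ).
have [c rb] : exists c, reach (b', Some c) /\ (b' \in Z -> c).
  have: exists c : bool, reach (b, Some c) /\ (b \in Z -> c).
    by exists (b \in Z); split=> //; apply: down.
  case/connectP: bb' => q qq ->; elim: q b qq {ub bW} => //= t q IHq s /andP[st qq] [c [r _]].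
  apply: IHq qq _; have /and3P[_ _ u'] := st.
  by exists (c || (t \in Z)); split; [apply: head_und u' r|move=> ->; rewrite orbT].
case: rb; case: c => [r _|r b'Z]; first by right; left; apply: ascend vb' vZ _ r.
have {}b'Z : b' \notin Z by apply/negP=> /b'Z.
case: (at_head b'W b'Z r) => [|[]r']; [by left|right; left|right; left].
  exact: ascend vb' vZ _ r'.
exact: ascend vb' vZ _ r'.
Qed.

End MoralOpen.

Theorem lopen_transfer (T : finType) (G H : graph T) :
  is_CG G -> is_CG H -> adj G =2 adj H ->
  (forall (W : {set T}) a c, a != c -> ~~ adj G a c -> via G W a c = via H W a c) ->
  forall (Z : {set T}) x y, lopen G Z x y -> lopen H Z x y.
Proof.
move=> cgG cgH adjE viaE Z x y op; have [xZ _] := op.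
have := open_moral cgG op; set W0 := [set v | _] => mor0.
pose A := [set x; y] :|: Z.
have [xA yA] : x \in A /\ y \in A by rewrite !inE !eqxx orbT.
suff main n (W : {set T}) : #|W| < n -> (forall w, w \in W -> anterior G W A w) ->
    connect (mor G W Z) x y -> lopen H Z x y.
  apply: (main #|W0|.+1 W0) => // w; rewrite inE => /existsP[a /andP[aA /connectP[p pp e]]].
  exists a => //; elim: p w pp e => [|v p IH] w /= pp e; first by rewrite e; apply: connect0.
  case/andP: pp => wv pp; apply: connect_trans (connect1 _) (IH v pp e).
  have W0c u q : path (semi G) u q -> a = last u q -> u \in W0.
    move=> uq eq; rewrite inE; apply/existsP; exists a; rewrite aA.
    by apply/connectP; exists q.
  rewrite semi_ind wv (W0c v p pp e) (W0c w (v :: p)) //=; exact/andP.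
elim: n W => // n IHn W Wn ant mW.
case: (classic (exists2 w, w \in W & ~ anterior H W A w)) => [[w wW nant]|all]; last first.
  apply: (moral_open cgH xZ (W := W)).
    by move=> w wW; apply: NNPP => na; apply: all; exists w.
  apply: connect_sub mW => a c; have [->|ac] := eqVneq a c; first by rewrite connect0.
  move=> /and3P[aW cW l]; apply: connect1; apply/and3P; split=> //.
  case/orP: l => [l|l]; first by rewrite -adjE l.
  by have [acH|nac] := boolP (adj G a c); [rewrite -adjE acH|rewrite -viaE // l orbT].
have [K KH [[k kK] Kw]] := terminal_block_above (gdel_CG (~: W) cgH) w.
have KW : K \subset W.
  apply/subsetP=> k' /Kw /connectP[p]; case: (lastP p) => [_ /= ->//|q v].
  rewrite rcons_path last_rcons => /andP[_ st] ->.
  by move: st; rewrite semi_ind => /and3P[].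
have KA : [disjoint K & A].
  rewrite -setI_eq0; apply/eqP/setP=> a; rewrite in_set0; apply/negP=> /setIP[aK aA].
  by apply: nant; exists a => //; apply: Kw.
apply: (IHn (W :\: K)).
- rewrite -ltnS; apply: leq_trans Wn; rewrite ltnS; apply: proper_card.
  apply/properP; split; first exact: subsetDl.
  by exists k; [apply: (subsetP KW)|rewrite inE kK].
- by move=> v vW; apply: (anterior_peel cgG adjE viaE KW KA KH ant).
- by apply: (moral_peel cgG cgH adjE viaE KW KA KH ant xA yA).
Qed.

(** * Separating nonadjacent nodes, and the two interpretations together *)

Section AMPSeparable.
Variables (T : finType) (G : graph T).
Hypothesis cgG : is_CG G.
Let simG := cg_simple cgG.
Let adjC : symmetric (adj G) := cg_adj_sym cgG.

(** An open route from [y] either stays among the nodes reachable from [y], or goes from [y] to a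
    parent. That parent lies in [Z] and is entered by a tail, so the route ends there. *)
Lemma amp_separable_above x y : ~~ connect (semi G) y x -> ~~ adj G x y ->
  exists Z : {set T}, [/\ x \notin Z, y \notin Z & ~~ aopen G Z y x].
Proof.
move=> nyx nxy; pose Z := [set v | ~~ connect (semi G) y v && (v != x)].
have yy := connect0 (semi G) y.
exists Z; split; rewrite ?inE ?eqxx ?andbF ?yy //.
have up v : v \notin Z -> (v == x) || connect (semi G) y v.
  by rewrite inE negb_and !negbK orbC.
have inv n v m : rch G Z y n (v, m) ->
    (connect (semi G) y v /\ (m = Some false -> v = y)) \/ (v \in Z /\ m = Some false).
  elim: n v m => [|n IH] w mw; first by case/eqP=> -> _; left.
  case/rch_inv=> v [m [/IH iv avw -> tv]].
  case: iv => [[yv mt]|[vZ me]]; last by move: tv; rewrite me vZ triC tri_tail.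
  have vZ : (v \in Z) = false by rewrite inE yv.
  rewrite vZ in tv; have [yw|yw] := boolP (connect (semi G) y w).
    left; split=> // e; have dwv : dir G w v.
      case/or3P: avw => // d; first by rewrite (mk_dir d) in e.
      by rewrite (mk_und simG d) in e.
    have mf : m = Some false by move: tv; rewrite (mk_dir dwv); case: (m) => [[]|].
    by rewrite (mt mf) in dwv; case: (cg_no_cycle cgG dwv yw).
  have dwv : dir G w v.
    have nvw : ~ semi G v w.
      by move=> s; case/negP: yw; apply: connect_trans yv (connect1 s).
    case/or3P: avw => // d; case: nvw; rewrite /semi ?d ?orbT //.
  have mf : m = Some false by move: tv; rewrite (mk_dir dwv); case: (m) => [[]|].
  right; split; last exact: (mk_rid simG dwv).
  rewrite inE yw /=; apply: contra nxy => /eqP wx.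
  by rewrite -wx -(mt mf) adjC.
apply/negP=> /aopen_rch[xZ [n [m /inv]]].
by case=> [[yx _]|[h _]]; [rewrite yx in nyx|rewrite h in xZ].
Qed.

(** Here [Z] also contains the rest of the chain component. A neighbour of [y] in it, entered by an
    undirected edge, can be left only towards a parent, which again lies in [Z] and is entered by a
    tail. *)
Lemma amp_separable_beside x y : x != y -> connect (semi G) y x -> connect (semi G) x y ->
  ~~ adj G x y ->
  exists Z : {set T}, [/\ x \notin Z, y \notin Z & ~~ aopen G Z y x].
Proof.
move=> xy yx xy' nxy.
pose above v := connect (semi G) y v; pose back v := connect (semi G) v y.
pose Z := [set v | ~~ (above v && ~~ back v) & (v != x) && (v != y)].
exists Z; split; rewrite ?inE ?eqxx ?andbF //.
have aboveS v w : above v -> semi G v w -> above w.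
  by move=> yv s; apply: connect_trans yv (connect1 s).
have backS v w : back w -> semi G v w -> back v.
  by move=> yv s; apply: connect_trans (connect1 s) yv.
have inv n v m : rch G Z y n (v, m) ->
    [\/ v = y /\ m = Some false, [/\ above v, ~~ back v & m <> Some false],
        [/\ v \in Z, above v, back v & m = None] | ~~ above v /\ m = Some false].
  elim: n v m => [|n IH] w mw; first by case/eqP=> -> ->; apply: Or41.
  case/rch_inv=> v [m [/IH iv avw -> tv]].
  case: iv => [[vy me]|[av nb mne]|[vZ av bv me]|[nav me]].
  - rewrite vy in avw *.
    case/or3P: avw => d.
    + have aw : above w by apply: connect1; rewrite /semi d.
      apply: Or42; split=> //; last by rewrite (mk_dir d).
      by apply/negP=> bw; apply: (cg_no_cycle cgG d bw).
    + apply: Or44; split; last exact: (mk_rid simG d).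
      by apply/negP=> aw; apply: (cg_no_cycle cgG d aw).
    + have d' : und G w y by rewrite cg_und_sym.
      have aw : above w by apply: und_connect.
      have bw : back w by apply: und_connect.
      apply: Or43; split=> //; last exact: (mk_und simG d).
      rewrite inE aw bw /=; apply/andP; split.
        by apply: contra nxy => /eqP <-; rewrite /adj d' !orbT.
      by apply/eqP=> wy; rewrite wy in d; case: simG => _ /(_ y) + _ _ _; rewrite d.
  - have vZ : (v \in Z) = false by rewrite inE av nb.
    rewrite vZ in tv; have svw : semi G v w.
      case/or3P: avw => d; rewrite /semi ?d ?orbT //.
      by move: tv mne; rewrite (mk_dir d); case: (m) => [[]|].
    apply: Or42; split; first exact: aboveS av svw.
      by apply: contra nb => bw; apply: backS bw svw.
    by case/orP: svw => d; rewrite ?(mk_dir d) ?(mk_und simG d).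
  - have dwv : dir G w v.
      rewrite vZ me in tv; case/or3P: avw => // d.
        by move: tv; rewrite (mk_rid simG d).
      by move: tv; rewrite (mk_dnu simG d).
    apply: Or44; split; last exact: (mk_rid simG dwv).
    by apply/negP=> aw; apply: (cg_no_cycle cgG dwv); apply: connect_trans bv aw.
  - have vZ : v \in Z.
      rewrite inE (negbTE nav) /=; apply/andP; split; apply: contra nav => /eqP-> //.
      exact: connect0.
    by move: tv; rewrite me vZ triC tri_tail.
apply/negP=> /aopen_rch[xZ [n [m /inv]]].
case=> [[e _]|[_ nb _]|[h _ _ _]|[na _]].
- by rewrite e eqxx in xy.
- by rewrite /back xy' in nb.
- by rewrite h in xZ.
- by rewrite /above yx in na.
Qed.

Lemma amp_separable x y : x != y -> ~~ adj G x y ->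
  exists Z : {set T}, [/\ x \notin Z, y \notin Z & ~~ aopen G Z x y].
Proof.
move=> xy nxy; have nyx : ~~ adj G y x by rewrite adjC.
have [yx|yx] := boolP (connect (semi G) y x); last first.
  by have [Z [xZ yZ nop]] := amp_separable_above yx nxy; exists Z; rewrite aopen_sym.
have [xy'|xy'] := boolP (connect (semi G) x y); last first.
  by have [Z [yZ xZ nop]] := amp_separable_above xy' nyx; exists Z.
by have [Z [xZ yZ nop]] := amp_separable_beside xy yx xy' nxy; exists Z; rewrite aopen_sym.
Qed.

End AMPSeparable.

Definition connects (i : interp) (T : finType) (G : graph T) (Z : {set T}) (x y : T) : Prop :=
  match i with LWF => lopen G Z x y | AMP => aopen G Z x y end.

Section Connects.
Variable i : interp.
Implicit Types T : finType.

Lemma connectsP T (G : graph T) Z x y : simple_graph G ->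
  (exists q, [/\ route G x q, last x q = y & Z_open i G Z x q]) <-> connects i G Z x y.
Proof. by move=> sG; case: i; [apply: lopenP|apply: aopenP]. Qed.

Lemma indep_modelP T (G : graph T) (X Y Z : {set T}) : simple_graph G ->
  indep_model i G X Y Z <-> disjoint3 X Y Z /\
    forall x y, x \in X -> y \in Y -> ~ connects i G Z x y.
Proof.
move=> sG; split=> -[dXYZ nop]; split=> //.
  move=> x y xX yY /(connectsP _ _ _ sG)[q [rt e op]].
  by apply: nop; exists x, q; split=> //; rewrite e.
move=> [x [q [rt xX yY op]]]; apply: (nop x (last x q)) => //.
by apply/connectsP => //; exists q.
Qed.

Lemma disjoint3_pt T (x y : T) (Z : {set T}) :
  disjoint3 [set x] [set y] Z = [&& x != y, x \notin Z & y \notin Z].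
Proof. by rewrite /disjoint3 !disjoints1 in_set1. Qed.

Lemma indep_pt T (G : graph T) x y (Z : {set T}) : simple_graph G ->
  indep_model i G [set x] [set y] Z <->
  [/\ x != y, x \notin Z, y \notin Z & ~ connects i G Z x y].
Proof.
move=> sG; rewrite indep_modelP // disjoint3_pt.
split=> [[/and3P[xy xZ yZ] h]|[-> -> -> h]]; first by split=> //; apply: h; rewrite inE.
by split=> // a b; rewrite !inE => /eqP-> /eqP->.
Qed.

Lemma connects_adj T (G : graph T) (Z : {set T}) x y : simple_graph G ->
  adj G x y -> x \notin Z -> y \notin Z -> connects i G Z x y.
Proof.
move=> sG xy xZ yZ; case: i; last first.
  apply/aopen_rch; split=> //; exists 1, (mk G x y); apply: rchS (rch0 G Z x) xy _.
  by rewrite triC tri_tail (negbTE xZ).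
split=> //; case/or3P: xy => d; [exists (Some false)|exists None|exists None] => //.
- by apply: connect1; apply/lstepP; apply: Or33; rewrite (negbTE yZ).
- by apply: connect1; apply/lstepP; apply: Or32.
- by apply: connect1; apply/lstepP; apply: Or31.
Qed.

Lemma separable T (G : graph T) x y : is_CG G -> x != y -> ~~ adj G x y ->
  exists Z : {set T}, [/\ x \notin Z, y \notin Z & ~ connects i G Z x y].
Proof.
move=> cg xy nxy; case: i; first exact: lwf_separable.
by have [Z [xZ yZ /negP n]] := amp_separable cg xy nxy; exists Z.
Qed.

Lemma connects_transfer T (G H : graph T) : is_CG G -> is_CG H -> adj G =2 adj H ->
  (forall (Z : {set T}) x y, x != y -> x \notin Z -> y \notin Z ->
    connects i H Z x y -> connects i G Z x y) ->
  forall (Z : {set T}) x y, connects i G Z x y -> connects i H Z x y.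
Proof.
move=> cgG cgH adjE HG; case: i HG => HG.
  by apply: lopen_transfer => // W a c; apply: via_same.
apply: aopen_transfer => // a b c ab bc /eqP ac nac.
have [Z [aZ cZ nop]] := amp_separable cgG ac nac.
(* As [Z] blocks the route [a], [b], [c], the status of [b] as a triplex node is opposite to its
   membership in [Z]; the same [Z] serves both graphs. *)
have blocked (F : graph T) : is_CG F -> adj F =2 adj G -> ~~ aopen F Z a c ->
    tri (mk F a b) (mk F c b) = (b \notin Z).
  move=> cgF FE nF; have [t|] := eqVneq (tri (mk F a b) (mk F c b)) (b \in Z); last first.
    by case: (tri _ _); case: (b \in Z).
  case/negP: nF; apply/aopen_rch; split=> //.
  exists 2, (mk F b c); apply: (@rchS _ F Z a 1 b (mk F a b)); rewrite ?FE //.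
  apply: (@rchS _ F Z a 0 a (Some false)); rewrite ?FE ?rch0 //.
  by rewrite triC tri_tail (negbTE aZ).
rewrite (blocked G) // (blocked H) //; apply/negP=> /(HG _ _ _ ac aZ cZ).
exact/negP.
Qed.

End Connects.

(** * The model built from [G_D] and [G_S] *)

Section Models.
Variables (i : interp) (V : finType) (G : graph V).
Hypothesis cgG : is_CG G.
Let simG := cg_simple cgG.

Lemma simple_G_D : simple_graph (G_D G).
Proof. by case: simG => di _ _ ds _; split=> // x y; rewrite /= andbF. Qed.

Lemma simple_G_S : simple_graph (G_S G).
Proof. by split=> // [[x|A]|[x|A] [y|B]|[x|A] [y|B]] //=; rewrite ?andbF. Qed.

Lemma connects_G_D Z x y : connects i (G_D G) Z x y -> connects i G Z x y.
Proof.
case: i => [[xZ [s s1 c]]|/andP[yZ /existsP[m c]]].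
  split=> //; exists s => //; apply: connect_sub c => -[v st] [w sw] /lstepP stp.
  apply: connect1; apply/lstepP.
  by case: stp => [[]//|h|h]; [apply: Or32|apply: Or33].
apply/andP; split=> //; apply/existsP; exists m; apply: connect_sub c => -[v mv] [w mw].
case/and3P=> avw /eqP /= -> tv; apply: connect1.
have mkE a b : adj (G_D G) a b -> mk (G_D G) a b = mk G a b.
  rewrite /adj /= orbF /mk /=; case: (dir G a b) => //= d.
  by rewrite (dir_und' cgG d).
have awv : adj (G_D G) w v by move: avw; rewrite /adj /= !orbF orbC.
rewrite /astep /= (mkE _ _ avw) eqxx -(mkE _ _ awv) tv.
by move: avw; rewrite /adj /= orbF => /orP[]->; rewrite ?orbT.
Qed.

Lemma Snode_und (A : Snode G) v w : v \in val A -> w \in val A -> (v == w) || und G v w.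
Proof.
case: A => A /= /existsP[a /existsP[b /andP[ab /eqP->]]].
rewrite !inE => /orP[]/eqP-> /orP[]/eqP->; rewrite ?eqxx ?ab ?orbT //.
by rewrite cg_und_sym // ab orbT.
Qed.

Let inZ (Z : {set V}) : {set V + Snode G} := (inl @: Z) :|: (inr @: [set: Snode G]).

Lemma inl_inZ Z v : (inl v \in inZ Z) = (v \in Z).
Proof.
rewrite inE mem_imset; last by move=> a b [].
by case: (v \in Z) => //=; apply/imsetP=> -[].
Qed.

Lemma inr_inZ Z A : inr A \in inZ Z.
Proof. by rewrite inE; apply/orP; right; apply: imset_f. Qed.

(** Passing a node of [S] means returning or crossing an undirected edge of [G]. The nodes of [V] on
    the route are not colliders, so the route becomes an undirected one of [G] outside [Z]. *)
Lemma connects_G_S Z x y : connects i (G_S G) (inZ Z) (inl x) (inl y) -> connects i G Z x y.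
Proof.
case: i => [[]|/andP[]]; rewrite inl_inZ.
  move=> xZ [s s1 /connectP[p pp e]]; split=> //; exists None => //.
  pose inv (u : (V + Snode G) * option bool) := match u with
    | (inl v, s) => s = None /\ connect (lstep G Z) (x, None) (v, None)
    | (inr A, s) => exists2 v, v \in val A & connect (lstep G Z) (x, None) (v, None) end.
  suff: inv (inl y, s) by case.
  rewrite e; have: inv (inl x, None) by split=> //; apply: connect0.
  elim: p (inl x, None) pp {e} => //= u p IH w /andP[st pp] iw; apply: IH pp _.
  case: w u st iw => [[v|A] sv] [[w|B] sw] /lstepP[[]|[]|[]] //=.
  - by move=> vB _ _ [_ c]; exists v.
  - move=> wA _ ->; rewrite inl_inZ => wZ [v vA c]; split=> //.
    case/orP: (Snode_und vA wA) => [/eqP<-//|u].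
    by apply: connect_trans c (connect1 _); apply/lstepP; apply: Or31.
move=> yZ /existsP[m /connectP[p pp e]]; apply/andP; split=> //.
pose ok v := exists2 m', m' != Some true & connect (astep G Z) (x, Some false) (v, m').
pose inv (u : (V + Snode G) * option bool) := match u with
  | (inl v, s) => s = Some false /\ ok v
  | (inr A, s) => exists2 v, v \in val A & v \notin Z /\ ok v end.
suff: inv (inl y, m) by case=> _ [m' _ c]; apply/existsP; exists m'.
rewrite e; have: inv (inl x, Some false).
  by split=> //; exists (Some false) => //; apply: connect0.
elim: p (inl x, Some false) pp {e} => //= u p IH w /andP[st pp] iw; apply: IH pp _.
case: w u st iw => [[v|A] sv] [[w|B] sw] /and3P[] //=; rewrite /adj /= ?orbF.
- move=> vB _ + [svE okv]; rewrite svE triC tri_tail inl_inZ => /eqP vZ.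
  by exists v; rewrite -?vZ.
- move=> wA /eqP-> _ [v vA [vZ [m' m'1 c]]]; rewrite /mk /=; split=> //.
  case/orP: (Snode_und vA wA) => [/eqP<-|u]; first by exists m'.
  exists None => //; apply: connect_trans c (connect1 _).
  rewrite /astep /= /adj u !orbT (mk_und simG u) (mk_dnu simG u) (negbTE vZ) /=.
  by case: m' m'1 => [[]|].
Qed.

Lemma G_S_connects (Z : {set V}) x y : x \notin Z -> y \notin Z -> und G x y ->
  connects i (G_S G) (inZ Z) (inl x) (inl y).
Proof.
move=> xZ yZ xy.
have eA : uedge (und G) [set x; y].
  by apply/existsP; exists x; apply/existsP; exists y; rewrite xy /=.
pose A : Snode G := exist (fun B => uedge (und G) B) _ eA.
have xA : x \in val A by rewrite !inE eqxx.
have yA : y \in val A by rewrite !inE eqxx orbT.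
case: i.
  split; first by rewrite inl_inZ.
  exists None => //; apply: (@connect_trans _ _ (inr A, Some true)); apply: connect1.
    by apply/lstepP; apply: Or33; rewrite inr_inZ.
  by apply/lstepP; apply: Or32; rewrite inl_inZ.
apply/andP; split; first by rewrite inl_inZ.
apply/existsP; exists (Some false).
apply: (@connect_trans _ _ (inr A, Some true)); apply: connect1.
  by rewrite /astep /adj /= xA /mk /= xA inl_inZ (negbTE xZ).
by rewrite /astep /adj /= yA /mk /= yA inr_inZ.
Qed.

Lemma disjoint_inl (X Y : {set V}) : [disjoint X & Y] ->
  [disjoint (inl @: X : {set V + Snode G}) & inl @: Y].
Proof.
move=> XY; rewrite -setI_eq0 -imsetI; last by move=> a b _ _ [].
by move: XY; rewrite -setI_eq0 => /eqP->; rewrite imset0.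
Qed.

Lemma disjoint_inZ (X Z : {set V}) : [disjoint X & Z] ->
  [disjoint (inl @: X : {set V + Snode G}) & inZ Z].
Proof.
move=> XZ; rewrite disjoint_sym disjoints_subset subUset -!disjoints_subset.
rewrite disjoint_sym disjoint_inl //=.
rewrite -setI_eq0; apply/eqP/setP=> u; rewrite !inE; apply/negP=> /andP[].
by case/imsetP=> A _ -> /imsetP[].
Qed.

Lemma disjoint3_inZ (X Y Z : {set V}) : disjoint3 X Y Z ->
  disjoint3 (inl @: X : {set V + Snode G}) (inl @: Y) (inZ Z).
Proof. by case/and3P=> XY XZ YZ; apply/and3P; split; rewrite ?disjoint_inl ?disjoint_inZ. Qed.

Let M := model_cap (indep_model i (G_D G)) (marg_cond (indep_model i (G_S G)) [set: Snode G]).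

Lemma indep_model_sound : model_incl (indep_model i G) M.
Proof.
move=> X Y Z /indep_modelP[// | dXYZ nop]; split.
  apply/indep_modelP; first exact: simple_G_D.
  by split=> // x y xX yY /connects_G_D; apply: nop.
split=> //; apply/indep_modelP; first exact: simple_G_S.
split; first exact: disjoint3_inZ.
by move=> _ _ /imsetP[x xX ->] /imsetP[y yY ->] /connects_G_S; apply: nop.
Qed.

(** The ends of an edge of [G] stay connected in [G_D] or in [G_S] whatever is conditioned on, so no
    separator in [H] can exist. *)
Lemma adj_of_model H x y : is_CG H -> model_incl (indep_model i H) M ->
  adj G x y -> adj H x y.
Proof.
move=> cgH HM xy; apply/negPn/negP=> nxy.
have neq : x != y by apply/eqP=> e; rewrite e cg_adj_irr in xy.
have [Z [xZ yZ nop]] := separable i cgH neq nxy.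
have : indep_model i H [set x] [set y] Z by apply/indep_pt => //; apply: cg_simple.
case/HM=> /(indep_pt _ _ _ _ simple_G_D)[_ _ _ nD] [_].
rewrite !imset_set1 => /(indep_pt _ _ _ _ simple_G_S)[_ _ _ nS].
have [u|nu] := boolP (und G x y); first by apply: nS; apply: G_S_connects.
apply: nD; apply: connects_adj => //; first exact: simple_G_D.
by move: xy; rewrite /adj (negbTE nu).
Qed.

End Models.

Theorem theorem1 (i : interp) (V : finType) (G : graph V) :
  is_CG G ->
  inclusion_optimal i G
    (model_cap (indep_model i (G_D G))
               (marg_cond (indep_model i (G_S G)) [set: Snode G])).
Proof.
move=> cgG; split; first exact: indep_model_sound.
case=> H [cgH GH nHG HM]; apply: nHG.
have [sG sH] := (cg_simple cgG, cg_simple cgH).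
have HG (Z : {set V}) x y : x != y -> x \notin Z -> y \notin Z ->
    connects i H Z x y -> connects i G Z x y.
  move=> xy xZ yZ op; apply: NNPP => nop.
  have : indep_model i G [set x] [set y] Z by apply/indep_pt.
  by case/GH/(indep_pt _ _ _ _ sH).
have adjE : adj G =2 adj H.
  move=> x y; apply/idP/idP; first exact: adj_of_model HM.
  move=> xy; apply/negPn/negP=> nxy.
  have neq : x != y by apply/eqP=> e; rewrite e cg_adj_irr in xy.
  have [Z [xZ yZ nop]] := separable i cgG neq nxy.
  by apply: nop; apply: HG => //; apply: connects_adj.
move=> X Y Z /(indep_modelP _ _ _ _ sH)[dXYZ nop].
apply/indep_modelP => //; split=> // x y xX yY.
by move/(connects_transfer cgG cgH adjE HG); apply: nop.
Qed.
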